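(* Let $n\ge 2$ and let $u\in H^2_{\mathrm{per}}(\Omega)$ be a non-negative function which is a weak solution in the sense that $$\int_{-\pi}^{\pi}\Bigl[(u^n\varphi_\theta)_\theta\,(u_{\theta\theta}+u+\cos\theta)-\omega u\,\varphi_\theta\Bigr]\,d\theta=0\quad\text{for all }\varphi\in C^\infty_{\mathrm{per}}(\Omega).$$ If $S=\{\theta:u(\theta)>0\}\neq\Omega$, then $\omega=0$.
   Context: $\Omega=[-\pi,\pi)$, regarded as one period of the circle. $H^2_{\mathrm{per}}(\Omega)$ is the set of square integrable $2\pi$-periodic functions on $\Omega$ with two square integrable weak derivatives; functions are real-valued and identified with their continuous ($C^1$) representatives. $C^\infty_{\mathrm{per}}(\Omega)$ is the set of smooth $2\pi$-periodic functions. The exponent $n$ is a real number and $\omega$ is a real constant (rotation parameter). The integral identity is the weak form of the steady-state equation $(u^n(u_{\theta\theta\theta}+u_\theta-\sin\theta)+\omega u)_\theta=0$.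
   Formalization: The formal theorem additionally assumes that u is not identically zero; for u = 0 the claim fails, since the integral identity then holds for every ω while S is empty and so differs from Ω. *)

(* Defs.v *)
From HB Require Import structures.
From mathcomp Require Import all_boot all_order all_algebra.
From mathcomp Require Import all_classical all_reals all_analysis.

Set Implicit Arguments.
Unset Strict Implicit.
Unset Printing Implicit Defensive.

Import Order.TTheory GRing.Theory Num.Theory.
Import numFieldNormedType.Exports.

Local Open Scope classical_set_scope.
Local Open Scope ring_scope.

Definition Omega (R : realType) : set R := `[(- pi)%R, (pi : R)[%classic.
Arguments Omega {R}.

Definition Cinf_per (R : realType) (phi : R -> R) : Prop :=
  periodic phi (pi *+ 2) /\
  forall (k : nat) (x : R), derivable (derive1n k phi) x 1.

(* Only the values of [v] on [Omega] matter. *)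
Definition L2_Omega (R : realType) (v : R -> R) : Prop :=
  measurable_fun Omega v /\
  (@lebesgue_measure R).-integrable Omega (fun x => (v x ^+ 2)%:E).

(* [v] is a weak derivative of order [k] of [u] on the circle. Testing against
   periodic functions means that no boundary terms occur at -pi and pi; [v] is
   determined by this condition only almost everywhere on [Omega]. *)
Definition weak_deriv (R : realType) (k : nat) (u v : R -> R) : Prop :=
  L2_Omega v /\
  forall phi : R -> R, Cinf_per phi ->
    \int[@lebesgue_measure R]_(x in Omega) (u x * derive1n k phi x) =
    (- 1) ^+ k * \int[@lebesgue_measure R]_(x in Omega) (v x * phi x).

(* A class in H^2_per is represented by its 2 pi-periodic C^1 representative,
   defined on the whole line; this is what the last two conjuncts select. *)
Definition H2_per (R : realType) (u : R -> R) : Prop :=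
  [/\ periodic u (pi *+ 2),
      L2_Omega u,
      (exists v1 : R -> R, weak_deriv 1 u v1) /\
      (exists v2 : R -> R, weak_deriv 2 u v2),
      forall x : R, derivable u x 1
    & continuous (u^`()%classic : R -> R)].

(* For [u] nonnegative and C^1 and [n > 1], the factor [u ^ n * phi'] is C^1,
   so its derivative is the classical one. Only the second derivative [w] of [u]
   is weak; the choice of [w] in its almost-everywhere class is immaterial. *)
Definition weak_solution (R : realType) (n omega : R) (u : R -> R) : Prop :=
  exists2 w : R -> R, weak_deriv 2 u w &
  forall phi : R -> R, Cinf_per phi ->
    \int[@lebesgue_measure R]_(x in Omega)
      ((fun y : R => (u y `^ n) * phi^`()%classic y)^`()%classic x
         * (w x + u x + cos x)
       - omega * u x * phi^`()%classic x) = 0.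

(* The set may be empty: [u = 0] is a weak solution for every [omega], so a
   conclusion [omega = 0] drawn from [positivity_set u <> Omega] needs [u] to be
   nontrivial. *)
Definition positivity_set (R : realType) (u : R -> R) : set R :=
  [set x | Omega x /\ 0 < u x].

(* Main.v *)
Require Import Defs.
From HB Require Import structures.
From mathcomp Require Import all_boot all_order all_algebra.
From mathcomp Require Import all_classical all_reals all_analysis.
From mathcomp Require Import ring lra.
Import Order.TTheory GRing.Theory Num.Theory.
Import numFieldNormedType.Exports.
Local Open Scope classical_set_scope.
Local Open Scope ring_scope.

(** Let [F = u'' + u + cos], which is square integrable on a period. Integrating
    the equation once gives, weakly on the whole circle,
    [u ^ n F' = - (omega u + c)] for some constant [c]
    ([exists_integration_constant]).

    Since [u] is nontrivial and has a zero, there is a point [a] with [u a = 0] and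
    [u > 0] immediately to the right of [a] ([zero_with_positive_right]). The zero
    is a minimum of [u], so [u' a = 0] as well; as [u'] is Hoelder continuous of
    exponent 1/2, because [u''] is square integrable, [u (a + s) <= C s ^ (3 / 2)]
    ([growth_at_zero]).

    Suppose [omega <> 0]. Then [omega u + c] keeps a constant sign to the right of
    [a] and dominates a multiple of [u] there, whether or not [c] vanishes
    ([linear_lower_bound]). Hence [F] is monotone there and
    [|F'| >= k u ^ (1 - n) >= k' s ^ (- 3 / 2)], where [2 <= n] is used. Such an [F]
    is at least of order [s ^ (- 1 / 2)] and cannot be square integrable: the exponent
    2 is exactly the borderline. In weak form, testing with a bump at distance [h]
    from [a] and of width comparable to [h] bounds the integral of [F ^ 2] over
    [[a + h, a + 3 h]] below by a constant that does not depend on [h]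
    ([one_scale_bound]), which is absurd as [h] tends to 0.

    These test functions involve [u ^ (- n)] and are only of class C1, whereas the
    hypotheses speak of smooth ones. The passage is [periodic_C1_test]: smooth
    tests include all trigonometric polynomials, and these are uniformly dense among
    continuous periodic functions ([trigpoly_dense]), hence, by taking primitives,
    dense in the C1 norm. *)

(** * Discrete Fejer kernels *)

Lemma periodicz (R : realType) (f : R -> R) : periodic f (pi *+ 2) ->
  forall (k : int) x, f (x + k%:~R * (pi *+ 2)) = f x.
Proof.
move=> fp [k|k] x; first by rewrite -pmulrn mulr_natl periodicn.
rewrite NegzE mulrNz -pmulrn mulNr -[LHS](periodicn fp k.+1) mulr_natl.
by rewrite subrK.
Qed.

Lemma period_reduction (R : realType) (x0 x : R) :
  exists k : int, - pi <= x + k%:~R * (pi *+ 2) - x0 < pi.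
Proof.
have p0 : (0 : R) < pi *+ 2 by rewrite mulrn_wgt0// pi_gt0.
exists (- Num.floor ((x - x0 + pi) / (pi *+ 2))).
have := Num.Theory.floor_itv ((x - x0 + pi) / (pi *+ 2)).
rewrite ler_pdivlMr// ltr_pdivrMr// mulrNz => /andP[].
set z := (Num.floor _)%:~R => h1; rewrite intrD -/z mulrDl mul1r => h2.
by apply/andP; split; lra.
Qed.

(** An inductive predicate rather than a sum over a list of coefficients, so that
    linear statements follow by induction. *)
Inductive trigpoly (R : realType) : (R -> R) -> Prop :=
| trigpoly_cos k : trigpoly R (fun x => cos (k%:R * x))
| trigpoly_sin k : trigpoly R (fun x => sin (k%:R * x))
| trigpolyD f g : trigpoly R f -> trigpoly R g -> trigpoly R (fun x => f x + g x)
| trigpolyZ c f : trigpoly R f -> trigpoly R (fun x => c * f x).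
Arguments trigpoly {R}.

Lemma trigpoly_sum (R : realType) (n : nat) (f : 'I_n -> R -> R) :
  (forall i, trigpoly (f i)) -> trigpoly (fun x => \sum_(i < n) f i x).
Proof.
elim: n f => [|n IH] f fT.
  rewrite (_ : (fun _ => _) = (fun x => 0 * cos (0%:R * x))).
    exact/trigpolyZ/trigpoly_cos.
  by apply/funext => x; rewrite big_ord0 mul0r.
under eq_fun do rewrite big_ord_recr/=.
by apply: trigpolyD => //; exact: IH.
Qed.

Lemma trigpoly_cos_shift (R : realType) (k l : nat) (y : R) :
  trigpoly (fun x => cos ((k%:R - l%:R) * (x - y))).
Proof.
wlog lk : k l / (l <= k)%N.
  move=> H; case: (leqP l k) => [|/ltnW] /H//.
  by under eq_fun do rewrite -cosN -mulNr opprB.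
rewrite -natrB//; move: (k - l)%N => m.
under eq_fun do rewrite mulrBr cosB.
apply: trigpolyD; under eq_fun do rewrite mulrC; apply: trigpolyZ.
- exact: trigpoly_cos.
- exact: trigpoly_sin.
Qed.

Section fejer.
Context (R : realType).
Implicit Types (N M k : nat) (s x : R).

Let dirc N s := \sum_(k < N) cos (k%:R * s).
Let dirs N s := \sum_(k < N) sin (k%:R * s).

(** The squared modulus of the sum of the [N] exponentials [exp (i k s)], that is,
    [N] times the Fejer kernel. *)
Definition fejer N s := dirc N s ^+ 2 + dirs N s ^+ 2.

Lemma fejer_ge0 N s : 0 <= fejer N s.
Proof. by rewrite addr_ge0// sqr_ge0. Qed.

Lemma fejerE N s :
  fejer N s = \sum_(k < N) \sum_(l < N) cos ((k%:R - l%:R) * s).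
Proof.
rewrite /fejer !expr2 /dirc /dirs !mulr_suml -big_split/=; apply: eq_bigr => k _.
rewrite !mulr_sumr -big_split/=; apply: eq_bigr => l _.
by rewrite mulrBl cosB.
Qed.

(** The squared modulus of the geometric sum
    [(exp (i s) - 1) * sum_(k < N) exp (i k s) = exp (i N s) - 1]; the real and
    imaginary parts of this identity are [hc] and [hs] in the proof. *)
Lemma fejer_cos N s : (1 - cos s) * fejer N s = 1 - cos (N%:R * s).
Proof.
have [hc hs] : cos s * dirc N s - sin s * dirs N s - dirc N s = cos (N%:R * s) - 1
   /\ sin s * dirc N s + cos s * dirs N s - dirs N s = sin (N%:R * s).
  rewrite /dirc /dirs; elim: N => [|N [IHc IHs]].
    by rewrite !big_ord0 !mul0r cos0 sin0 !mulr0; split; lra.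
  rewrite !big_ord_recr/= -natr1 mulrDl mul1r cosD sinD.
  move: IHc IHs; set C := \sum_(i < N) _; set S := \sum_(i < N) _ => IHc IHs.
  by split; [move: IHc|move: IHs]; nra.
rewrite /fejer; move: hc hs (cos2Dsin2 s) (cos2Dsin2 (N%:R * s)).
move: (cos s) (sin s) (cos (N%:R * s)) (sin (N%:R * s)) (dirc N s) (dirs N s).
move=> c s' cn sn C S hc hs h1 h2.
have e : (cn - 1) ^+ 2 + sn ^+ 2 = 2 * ((1 - c) * (C ^+ 2 + S ^+ 2)).
  rewrite -hc -hs.
  have -> : (c * C - s' * S - C) ^+ 2 + (s' * C + c * S - S) ^+ 2 =
     (c ^+ 2 + s' ^+ 2 + 1 - 2 * c) * (C ^+ 2 + S ^+ 2) by ring.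
  by rewrite h1; ring.
have e2 : (cn - 1) ^+ 2 + sn ^+ 2 = 2 * (1 - cn).
  have -> : (cn - 1) ^+ 2 + sn ^+ 2 = cn ^+ 2 + sn ^+ 2 + 1 - 2 * cn by ring.
  by rewrite h2; ring.
by apply: (mulfI (_ : 2 != 0 :> R)); rewrite ?pnatr_eq0// -e e2.
Qed.

Definition node M (j : nat) : R := j%:R * ((pi *+ 2) / M%:R).

(** The sum telescopes after multiplication by the sine of half the step [2 z],
    which is nonzero because [k < M]. *)
Lemma sum_cos_node M k x : (0 < k < M)%N ->
  \sum_(j < M) cos (k%:R * (x - node M j)) = 0.
Proof.
move=> /andP[k0 kM].
have M0 : (0 : R) < M%:R by rewrite ltr0n (ltn_trans k0 kM).
pose z : R := k%:R * (pi / M%:R).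
have sz : sin z != 0.
  apply/lt0r_neq0/sin_gt0_pi/andP; split.
    by rewrite mulr_gt0 ?ltr0n// divr_gt0// pi_gt0.
  rewrite /z mulrA ltr_pdivrMr// mulrC ltr_pM2l ?pi_gt0//.
  by rewrite ltr_nat.
apply: (mulfI sz); rewrite mulr0.
pose f (j : nat) := - sin (k%:R * x - j%:R * (z *+ 2) + z) / 2.
rewrite mulr_sumr.
rewrite (eq_bigr (fun j : 'I_M => f j.+1 - f j)); last first.
  move=> j _; rewrite /f.
  have -> : k%:R * x - j.+1%:R * (z *+ 2) + z = k%:R * (x - node M j) - z.
    by rewrite /node /z -natr1; field; rewrite lt0r_neq0.
  have -> : k%:R * x - j%:R * (z *+ 2) + z = k%:R * (x - node M j) + z.
    by rewrite /node /z; field; rewrite lt0r_neq0.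
  by rewrite sinB sinD; field.
rewrite -(big_mkord xpredT (fun j => f j.+1 - f j)) telescope_sumr//.
rewrite /f mul0r subr0.
have -> : k%:R * x + z = (k%:R * x - M%:R * (z *+ 2) + z) + (pi *+ 2) *+ k.
  by rewrite /z -[(pi *+ 2) *+ k]mulr_natl; field; rewrite lt0r_neq0.
by rewrite (periodicn (@sinD2pi R)) subrr.
Qed.

(** By the orthogonality of the nodes only the diagonal terms of [fejerE] survive:
    sums over at least [N] nodes behave like integrals. *)
Lemma sum_fejer_node M N x : (N <= M)%N ->
  \sum_(j < M) fejer N (x - node M j) = N%:R * M%:R.
Proof.
move=> NM; under eq_bigr do rewrite fejerE.
rewrite exchange_big/=.
rewrite (eq_bigr (fun=> M%:R)); last first.
  move=> k _; rewrite exchange_big/= (bigD1 k)//= [X in _ + X]big1 ?addr0.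
    rewrite (eq_bigr (fun=> 1)) => [|j _]; last by rewrite subrr mul0r cos0.
    by rewrite sumr_const card_ord.
  move=> l lk; case: (ltngtP l k) => [lt|lt|/val_inj e]; last first.
  - by rewrite e eqxx in lk.
  - under eq_bigr do rewrite -cosN -mulNr opprB -(natrB _ (ltnW lt)).
    apply: sum_cos_node; rewrite subn_gt0 lt/=.
    by apply: (leq_ltn_trans (leq_subr _ _)); exact: leq_trans (ltn_ord l) NM.
  - under eq_bigr do rewrite -(natrB _ (ltnW lt)).
    apply: sum_cos_node; rewrite subn_gt0 lt/=.
    by apply: (leq_ltn_trans (leq_subr _ _)); exact: leq_trans (ltn_ord k) NM.
by rewrite sumr_const card_ord -[LHS]mulr_natl.
Qed.

(** Compared with the total mass [N M], this says that the kernel concentrates at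
    the multiples of [2 pi] at the rate [1 / N]. *)
Lemma sum_fejer_cos_node M N x : (0 < N < M)%N ->
  \sum_(j < M) (1 - cos (x - node M j)) * fejer N (x - node M j) = M%:R.
Proof.
move=> NM; under eq_bigr do rewrite fejer_cos.
by rewrite big_split/= sumr_const card_ord sumrN sum_cos_node// subr0.
Qed.

End fejer.

(** * Density of trigonometric polynomials *)

Lemma periodic_bounded (R : realType) (g : R -> R) :
  continuous g -> periodic g (pi *+ 2) ->
  exists2 B, 0 < B & forall x, `|g x| <= B.
Proof.
move=> gc gp.
have pp : - pi <= (pi : R) by have := pi_ge0 R; lra.
have [c _ cmax] := @EVT_max R (fun x => `|g x|) (- pi) pi pp
  (continuous_subspaceT (fun x => cvg_norm (gc x))).
exists (`|g c| + 1) => [|x]; first by rewrite ltr_pwDr.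
have [k /andP[h1 h2]] := period_reduction R 0 x; rewrite subr0 in h1 h2.
rewrite -(periodicz R g gp k x) (le_trans (cmax _ _)) ?lerDl//.
by rewrite in_itv/= h1 ltW.
Qed.

Lemma segment_unif_continuous (R : realType) (g : R -> R) (a b e : R) :
  continuous g -> 0 < e -> exists2 d, 0 < d &
  forall x y, a <= x <= b -> `|y - x| < d -> `|g y - g x| < e.
Proof.
move=> gc e0.
pose P (d x : R) := forall y, `|y - x| < d -> `|g y - g x| < e.
have cpt : compact `[a, b]%classic := @segment_compact R a b.
have /compact_near_coveringP := cpt.
move=> /(_ R (0 : R)^'+ P _) nc.
have near0 : \forall d \near (0 : R)^'+, `[a, b]%classic `<=` P d.
  apply: nc => x _.
  have /cvgrPdist_lt /(_ (e / 2)) := gc x.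
  rewrite divr_gt0// => /(_ isT) [d /= d0 gd].
  exists (ball x (d / 2), [set t | t < d / 2]) => /=.
    split; first by apply: nbhsx_ballx; rewrite divr_gt0.
    by apply: nbhs_right_lt; rewrite divr_gt0.
  move=> [x' d'] [/= xx' dd'] y yx'.
  rewrite /ball/= in xx'.
  have h1 : `|g x - g y| < e / 2.
    apply: gd => /=; rewrite (_ : x - y = (x - x') + - (y - x')); last ring.
    by rewrite (le_lt_trans (ler_normD _ _))// normrN; lra.
  have h2 : `|g x - g x'| < e / 2 by apply: gd => /=; lra.
  rewrite (_ : g y - g x' = (g x - g x') + - (g x - g y)); last ring.
  by rewrite (le_lt_trans (ler_normD _ _))// normrN; lra.
have [d /= d0 hd] : \forall d \near (0:R)^'+, 0 < d /\ (`[a, b]%classic `<=` P d).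
  near=> d; split; near: d; [exact: nbhs_right_gt|exact: near0].
exists (d / 2) => [|x y /andP[ax xb] yx]; first by rewrite divr_gt0.
have [||_ h] := hd (d / 2) => //=.
- by rewrite sub0r normrN gtr0_norm; lra.
- by lra.
by apply: (h x) => //=; rewrite in_itv/= ax.
Unshelve. all: by end_near. Qed.

(** Near the diagonal this is uniform continuity; away from it [1 - cos (x - y)] is
    bounded below and boundedness of [g] suffices. The weight [1 - cos] is the one
    whose sum against the Fejer kernel is explicit. *)
Lemma periodic_modulus (R : realType) (g : R -> R) (e : R) :
  continuous g -> periodic g (pi *+ 2) -> 0 < e ->
  exists2 K, 0 <= K & forall x y, `|g y - g x| <= e + K * (1 - cos (x - y)).
Proof.
move=> gc gp e0.
have [B B0 gB] := periodic_bounded R g gc gp.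
have [d d0 gd] := segment_unif_continuous R g (- pi) pi e gc e0.
have Kx x : 0 <= 1 - cos x :> R by rewrite subr_ge0 cos_le1.
exists (2 * B / (1 - cos d)) => [|x y].
  by rewrite mulr_ge0 ?invr_ge0// mulr_ge0// ltW.
have [k /andP[]] := period_reduction R 0 x; rewrite subr0 => xl xr.
have [l /andP[]] := period_reduction R (x + k%:~R * (pi *+ 2)) y.
rewrite -(periodicz R g gp k x) -(periodicz R g gp l y).
have -> : cos (x - y) =
   cos ((y + l%:~R * (pi *+ 2)) - (x + k%:~R * (pi *+ 2))).
  rewrite -cosN opprB -(periodicz R _ (@cosD2pi R) (l - k) (y - x)) intrB.
  by congr cos; ring.
set x' := x + _; set y' := y + _ => yl yr.
have [lt|ge] := ltP `|y' - x'| d.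
  rewrite -[leLHS]addr0 lerD//; last by rewrite mulr_ge0// mulr_ge0// ?invr_ge0// mulr_ge0// ltW.
  by apply/ltW/gd => //; rewrite xl ltW.
have np : `|y' - x'| <= pi by rewrite ler_norml; lra.
have c1 : 0 < 1 - cos d.
  rewrite subr_gt0 -[ltRHS](@cos0 R) ltr_cos// in_itv/= ?lexx ?pi_ge0//.
  by rewrite ltW//= (le_trans ge).
have c2 : 1 - cos d <= 1 - cos (y' - x').
  rewrite -(cos_norm (y' - x')) lerD2l lerN2.
  move: ge; rewrite le_eqVlt => /orP[/eqP<-//|lt].
  by apply/ltW; rewrite ltr_cos// in_itv/= ?normr_ge0// ltW//= (le_trans (ltW lt)).
rewrite (le_trans (ler_normB _ _))//.
apply: (@le_trans _ _ (2 * B)).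
  by rewrite mulr_natl mulr2n lerD.
rewrite -[leLHS]add0r lerD ?(ltW e0)// mulrAC ler_pdivlMr//.
by rewrite ler_pM2l// mulr_gt0.
Qed.

(** The approximation is the convolution of [g] with the Fejer kernel, with the
    integral replaced by the mean over [N + 1] nodes. Its error is at most
    [e / 2 + K / N] by [periodic_modulus] and the two sums of the kernel. *)
Theorem trigpoly_dense (R : realType) (g : R -> R) (e : R) :
  continuous g -> periodic g (pi *+ 2) -> 0 < e ->
  exists2 T, trigpoly T & forall x, `|T x - g x| <= e.
Proof.
move=> gc gp e0.
have e20 : 0 < e / 2 by rewrite divr_gt0.
have [K K0 gK] := periodic_modulus R g (e / 2) gc gp e20.
pose N := (Num.truncn (2 * K / e)).+1.
pose M := N.+1.
have NM0 : (0 : R) < N%:R * M%:R by rewrite mulr_gt0 ?ltr0n.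
have NMi : (0 : R) < (N%:R * M%:R)^-1 by rewrite invr_gt0.
have KN : K / N%:R <= e / 2.
  rewrite ler_pdivrMr ?ltr0n//.
  have := truncnS_gt (2 * K / e); rewrite -/N ltr_pdivrMr// => h.
  by rewrite ltW//; lra.
exists (fun x => \sum_(j < M) (g (node R M j) / (N%:R * M%:R)) * fejer R N (x - node R M j)).
  apply: trigpoly_sum => j; apply: trigpolyZ.
  under eq_fun do rewrite fejerE.
  by do 2 (apply: trigpoly_sum => ?); exact: trigpoly_cos_shift.
move=> x.
have -> : g x = \sum_(j < M) (g x / (N%:R * M%:R)) * fejer R N (x - node R M j).
  by rewrite -mulr_sumr sum_fejer_node// divfK// lt0r_neq0.
rewrite -sumrB (le_trans (ler_norm_sum _ _ _))//.
apply: (@le_trans _ _ (\sum_(j < M) ((e / 2) / (N%:R * M%:R) * fejer R N (x - node R M j)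
   + K / (N%:R * M%:R) * ((1 - cos (x - node R M j)) * fejer R N (x - node R M j))))).
  apply: ler_sum => j _.
  rewrite -mulrBl normrM (ger0_norm (fejer_ge0 _ _ _)) [K / _ * _]mulrA -mulrDl.
  rewrite ler_wpM2r ?fejer_ge0// -mulrBl normrM (gtr0_norm NMi).
  by rewrite (mulrAC K) -mulrDl ler_pM2r// gK.
rewrite big_split/= -!mulr_sumr sum_fejer_node// sum_fejer_cos_node//.
rewrite divfK ?lt0r_neq0// (_ : K / (N%:R * M%:R) * M%:R = K / N%:R).
  by lra.
  by field; rewrite !pnatr_eq0.
by rewrite /M ltnSn.
Qed.

(** * Testing against periodic functions of class C1 *)

Section integrals_over_a_period.
Context (R : realType).
Notation mu := (@lebesgue_measure R).
Implicit Types f g A B : R -> R.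

Lemma ctsD f g : continuous f -> continuous g -> continuous (fun x => f x + g x).
Proof. by move=> cf cg x; exact: cvgD (cf x) (cg x). Qed.

Lemma ctsB f g : continuous f -> continuous g -> continuous (fun x => f x - g x).
Proof. by move=> cf cg x; exact: cvgB (cf x) (cg x). Qed.

Lemma ctsN f : continuous f -> continuous (fun x => - f x).
Proof. by move=> cf x; exact: cvgN (cf x). Qed.

Lemma ctsM f g : continuous f -> continuous g -> continuous (fun x => f x * g x).
Proof. by move=> cf cg x; exact: cvgM (cf x) (cg x). Qed.

Lemma cts_cst (c : R) : continuous (fun _ : R => c).
Proof. by move=> x; exact: cvg_cst. Qed.

Lemma cts_comp f g : continuous f -> continuous g -> continuous (fun x => g (f x)).
Proof. by move=> cf cg x; exact: continuous_comp (cf x) (cg (f x)). Qed.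

Lemma cts_id : continuous (fun x : R => x).
Proof. by move=> x; exact: cvg_id. Qed.

Lemma cts_derive (f f' : R -> R) : (forall x : R, is_derive x (1 : R) f (f' x)) -> continuous f.
Proof.
by move=> df x; apply/differentiable_continuous/derivable1_diffP; have [] := df x.
Qed.

Lemma derive_lipschitz (f f' : R -> R) K : (forall x : R, is_derive x (1 : R) f (f' x)) ->
  (forall x, `|f' x| <= K) -> forall x y, `|f y - f x| <= K * `|y - x|.
Proof.
move=> df fK; have cf := cts_derive _ _ df.
have H x y : x <= y -> `|f y - f x| <= K * `|y - x|.
  move=> xy; have [c _ ->] := MVT_segment xy (fun z _ => df z) (continuous_subspaceT cf).
  by rewrite normrM ler_wpM2r.
by move=> x y; have [/H//|/ltW/H] := leP x y; rewrite distrC (distrC x).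
Qed.

Lemma measurable_Omega : measurable (@Omega R : set (measurableTypeR R)).
Proof. exact: measurable_itv. Qed.

Lemma integrable_EFinD (D : set R) f g : measurable (D : set (measurableTypeR R)) ->
  mu.-integrable D (EFin \o f) -> mu.-integrable D (EFin \o g) ->
  mu.-integrable D (EFin \o (fun x => f x + g x)).
Proof. by move=> mD iF iG; exact: (integrableD mD iF iG). Qed.

Lemma integrable_EFinB (D : set R) f g : measurable (D : set (measurableTypeR R)) ->
  mu.-integrable D (EFin \o f) -> mu.-integrable D (EFin \o g) ->
  mu.-integrable D (EFin \o (fun x => f x - g x)).
Proof. by move=> mD iF iG; exact: (integrableB mD iF iG). Qed.

Lemma integrable_EFinZ (D : set R) c f : measurable (D : set (measurableTypeR R)) ->
  mu.-integrable D (EFin \o f) ->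
  mu.-integrable D (EFin \o (fun x => c * f x)).
Proof. by move=> mD iF; exact: (integrableZl mD c iF). Qed.

Lemma integrable_continuous f (i : interval R) (a b : R) : [set` i] `<=` `[a, b] ->
  continuous f -> mu.-integrable [set` i] (EFin \o f).
Proof.
move=> iab fc; apply: (@integrableS _ _ _ mu `[a, b]) => //.
apply: continuous_compact_integrable; first exact: segment_compact.
exact: continuous_subspaceT.
Qed.

Lemma integrable_mul_continuous A f (i : interval R) (a b : R) :
  [set` i] `<=` `[a, b] -> continuous f ->
  mu.-integrable [set` i] (EFin \o A) ->
  mu.-integrable [set` i] (EFin \o (fun x => A x * f x)).
Proof.
move=> iab fc iA.
have [a_le_b|b_lt_a] := leP a b; last first.
  rewrite (_ : [set` i] = set0); first exact: integrable_set0.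
  apply/seteqP; split=> // x /iab; rewrite /= in_itv/= => /andP[ax xb].
  by have := lt_le_trans b_lt_a (le_trans ax xb); rewrite ltxx.
have [c _ cmax] := @EVT_max R (fun x => `|f x|) a b a_le_b
  (continuous_subspaceT (fun x => cvg_norm (fc x))).
rewrite (_ : EFin \o _ = (EFin \o f) \* (EFin \o A))%E; last first.
  by apply/funext => x /=; rewrite mulrC EFinM.
apply: integrableMr => //.
  by apply: measurable_funTS; exact: measurable_realfun.continuous_measurable_fun.
exists `|f c|; split; first exact: num_real.
move=> y fy x /iab xab /=; apply: (le_trans _ (ltW fy)).
exact: cmax.
Qed.

Lemma Omega_sub : @Omega R `<=` `[- pi, pi].
Proof. by apply: subset_itv; rewrite bnd_simp. Qed.

Lemma integrable_Omega_continuous f : continuous f -> mu.-integrable Omega (EFin \o f).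
Proof. exact: integrable_continuous Omega_sub. Qed.

Lemma integrable_Omega_mul A f : continuous f -> mu.-integrable Omega (EFin \o A) ->
  mu.-integrable Omega (EFin \o (fun x => A x * f x)).
Proof. exact: integrable_mul_continuous Omega_sub. Qed.

Lemma Rintegral_derive (f f' : R -> R) (a b : R) : a <= b ->
  (forall x : R, is_derive x (1 : R) f (f' x)) -> continuous f' ->
  \int[mu]_(x in `[a, b]) f' x = f b - f a.
Proof.
rewrite le_eqVlt => /orP[/eqP<-|ab] df cf'.
  by rewrite set_itv1 Rintegral_set1 subrr.
have cf := cts_derive _ _ df.
rewrite /Rintegral (@continuous_FTC2 _ _ f)//.
- exact: continuous_subspaceT.
- split; [by move=> x _; have [] := df x| |].
  + exact/cvg_at_right_filter/cf.
  + exact/cvg_at_left_filter/cf.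
- by move=> x _; rewrite derive1E; have [_ ->] := df x.
Qed.

Lemma Rintegral_Omega_derive (f f' : R -> R) : periodic f (pi *+ 2) ->
  (forall x : R, is_derive x (1 : R) f (f' x)) -> continuous f' ->
  \int[mu]_(x in Omega) f' x = 0.
Proof.
move=> fp df cf'; rewrite Rintegral_itv_bndo_bndc; last exact: integrable_Omega_continuous.
rewrite (Rintegral_derive f)//; last by have := pi_ge0 R; lra.
by rewrite -(fp (- pi)) (_ : - pi + pi *+ 2 = pi :> R) ?subrr//; ring.
Qed.

End integrals_over_a_period.

Section trigonometric_tests.
Context (R : realType).
Notation mu := (@lebesgue_measure R).
Variables (A B : R -> R).
Hypotheses (iA : mu.-integrable Omega (EFin \o A)) (iB : mu.-integrable Omega (EFin \o B)).

Let L (t t' : R -> R) := \int[mu]_(x in Omega) (A x * t' x + B x * t x).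

Let iL (t t' : R -> R) : continuous t -> continuous t' ->
  mu.-integrable Omega (EFin \o (fun x => A x * t' x + B x * t x)).
Proof.
by move=> ct ct'; apply: integrable_EFinD; 
  [exact: measurable_Omega|exact: integrable_Omega_mul|exact: integrable_Omega_mul].
Qed.

Let LD (s s' t t' : R -> R) : continuous s -> continuous s' -> continuous t -> continuous t' ->
  L (s \+ t) (s' \+ t') = L s s' + L t t'.
Proof.
move=> cs cs' ct ct'; rewrite /L -RintegralD; [|exact: measurable_Omega|exact: iL|exact: iL].
by apply: eq_Rintegral => x _ /=; ring.
Qed.

Let LZ (c : R) (s s' : R -> R) : continuous s -> continuous s' ->
  L (fun x => c * s x) (fun x => c * s' x) = c * L s s'.
Proof.
move=> cs cs'; rewrite /L -RintegralZl; [|exact: measurable_Omega|exact: iL].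
by apply: eq_Rintegral => x _ /=; ring.
Qed.

Hypothesis Lcos : forall k : nat,
  \int[mu]_(x in Omega) (A x * (- (k%:R * sin (k%:R * x))) + B x * cos (k%:R * x)) = 0.
Hypothesis Lsin : forall k : nat,
  \int[mu]_(x in Omega) (A x * (k%:R * cos (k%:R * x)) + B x * sin (k%:R * x)) = 0.

Let cont_cosk (k : R) : continuous (fun x : R => cos (k * x)).
Proof.
apply: (cts_comp _ (fun y => k * y) cos); last exact: continuous_cos.
by apply: ctsM; [exact: cts_cst|exact: cts_id].
Qed.

Let cont_sink (k : R) : continuous (fun x : R => sin (k * x)).
Proof.
apply: (cts_comp _ (fun y => k * y) sin); last exact: continuous_sin.
by apply: ctsM; [exact: cts_cst|exact: cts_id].
Qed.

(** Integrating term by term: apart from its constant term, a trigonometric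
    polynomial is the derivative of an admissible test function. *)
Lemma trigpoly_primitive (T : R -> R) : trigpoly T -> continuous T /\
  exists m t, [/\ periodic t (pi *+ 2), (forall x : R, is_derive x (1 : R) t (T x - m))
    & L t (fun x => T x - m) = 0].
Proof.
have cst0 : L (fun=> 0) (fun=> 0) = 0.
  by rewrite /L; under eq_Rintegral do rewrite !mulr0 addr0; rewrite Rintegral_cst ?mul0r//; exact: measurable_Omega.
have pern (k : nat) x : k%:R * (x + pi *+ 2) = k%:R * x + (pi *+ 2) *+ k :> R.
  by rewrite mulrDr mulr_natl [k%:R * (pi *+ 2)]mulr_natl.
elim=> {T} [[|k]|[|k]|f g _ [cf [m [t [pt dt Lt]]]] _ [cg [n [s [ps ds Ls]]]]
           |c f _ [cf [m [t [pt dt Lt]]]]].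
- split; first exact: cont_cosk.
  exists 1, (fun=> 0); split => // [x|].
    by rewrite mul0r cos0 subrr; exact: is_derive_cst.
  rewrite -[RHS]cst0; congr L; apply/funext => x; by rewrite mul0r cos0 subrr.
- split; first exact: cont_cosk.
  exists 0, (fun x => k.+1%:R^-1 * sin (k.+1%:R * x)); split => [x|x|].
  + by rewrite pern (periodicn (@sinD2pi R)).
  + apply: is_derive_eq; rewrite /GRing.scale/= subr0; field.
    by rewrite nat1r pnatr_eq0.
  + transitivity (k.+1%:R^-1 * L (fun x => sin (k.+1%:R * x)) (fun x => k.+1%:R * cos (k.+1%:R * x))).
      rewrite -LZ; [|exact: cont_sink|].
        congr (L _ _); apply/funext => x; rewrite subr0; field.
        by rewrite nat1r pnatr_eq0.
      by apply: ctsM => //; exact: cts_cst.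
    by rewrite /L Lsin mulr0.
- split; first exact: cont_sink.
  exists 0, (fun=> 0); split => // [x|].
    by rewrite mul0r sin0 subrr; exact: is_derive_cst.
  rewrite -[RHS]cst0; congr L; apply/funext => x; by rewrite mul0r sin0 subrr.
- split; first exact: cont_sink.
  exists 0, (fun x => - k.+1%:R^-1 * cos (k.+1%:R * x)); split => [x|x|].
  + by rewrite pern (periodicn (@cosD2pi R)).
  + apply: is_derive_eq; rewrite /GRing.scale/= subr0; field.
    by rewrite nat1r pnatr_eq0.
  + transitivity (- k.+1%:R^-1 * L (fun x => cos (k.+1%:R * x)) (fun x => - (k.+1%:R * sin (k.+1%:R * x)))).
      rewrite -LZ; [|exact: cont_cosk|].
        congr (L _ _); apply/funext => x; rewrite subr0; field.
        by rewrite nat1r pnatr_eq0.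
      by apply/ctsN/ctsM => //; exact: cts_cst.
    by rewrite /L Lcos mulr0.
- split; first exact: ctsD.
  exists (m + n), (t \+ s); split => [x|x|].
  + by rewrite /= pt ps.
  + by apply: is_derive_eq; ring.
  + rewrite (_ : (fun x => _) = (fun x => f x - m) \+ (fun x => g x - n)).
      rewrite LD ?Lt ?Ls ?addr0//; [exact: cts_derive dt| |exact: cts_derive ds|].
      - by apply: ctsB => //; exact: cts_cst.
      - by apply: ctsB => //; exact: cts_cst.
    by apply/funext => x /=; ring.
- split; first by apply: ctsM => //; exact: cts_cst.
  exists (c * m), (fun x => c * t x); split => [x|x|].
  + by rewrite pt.
  + by apply: is_derive_eq; rewrite /GRing.scale/=; ring.
  + under [X in L _ X]eq_fun do rewrite -mulrBr.
    rewrite LZ ?Lt ?mulr0//; first exact: cts_derive dt.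
    by apply: ctsB => //; exact: cts_cst.
Qed.

(** The functional [L] is continuous for the C1 norm, so it suffices to approximate
    [psi] in that norm. Let the trigonometric polynomial [T] be uniformly close to
    [g = psi'], and write [T = m + t'] with [L t = 0]. By Rolle's theorem
    [t' - psi'] vanishes somewhere, so the constant [m] is small; hence [t - psi] has
    a small derivative and is close to a constant, on which [L] vanishes too. *)
Lemma periodic_C1_test (psi g : R -> R) : periodic psi (pi *+ 2) ->
  (forall x : R, is_derive x (1 : R) psi (g x)) -> continuous g ->
  \int[mu]_(x in Omega) (A x * g x + B x * psi x) = 0.
Proof.
move=> pp dpsi cg.
have cpsi := cts_derive R _ _ dpsi.
have mO := measurable_Omega R.
pose C := 2 * (\int[mu]_(x in Omega) `|A x|) + 8 * (\int[mu]_(x in Omega) `|B x|).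
have C0 : 0 <= C.
  by rewrite addr_ge0// mulr_ge0// Rintegral_ge0.
have pi4 : pi <= 4 :> R by have := pihalf_lt2 R; lra.
have gp : periodic g (pi *+ 2).
  move=> x; have h1 := dpsi (x + pi *+ 2).
  have h2 : is_derive x (1 : R) (psi \o (fun y => y + pi *+ 2)) (g (x + pi *+ 2)).
    by apply: is_derive_eq; rewrite addr0 mulr1.
  have [_ <-] := h2; have [_ <-] := dpsi x; congr ('D_1 _ x).
  by apply/funext => y /=; rewrite pp.
suff H e : 0 < e -> `|L psi g| <= e * C.
  apply/eqP; rewrite -normr_le0 leNgt; apply/negP => L0.
  have := H (`|L psi g| / (2 * (C + 1))).
  rewrite divr_gt0 ?mulr_gt0 ?ltr_wpDl// => /(_ isT).
  rewrite mulrAC ler_pdivlMr ?mulr_gt0 ?ltr_wpDl//; nra.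
move=> e0.
have [T trT TG] := trigpoly_dense R g e cg gp e0.
have [cT [m [t [pt dt Lt]]]] := trigpoly_primitive T trT.
have ct := cts_derive R _ _ dt.
pose f x := t x - psi x; pose f' x := T x - m - g x.
have df (x : R) : is_derive x (1 : R) f (f' x) by apply: is_derive_eq.
have me : `|m| <= e.
  have [||||c _ [_ dc]] := @Rolle R f (- pi) pi.
  - by have := pi_gt0 R; lra.
  - by move=> x _; have [] := df x.
  - exact/continuous_subspaceT/(cts_derive R _ _ df).
  - by rewrite /f -(pt (- pi)) -(pp (- pi)) (_ : - pi + pi *+ 2 = pi :> R)//; ring.
  have [_] := df c; rewrite dc /f' => h.
  by rewrite (_ : m = T c - g c)//; lra.
have f'e x : `|f' x| <= 2 * e.
  rewrite (_ : f' x = (T x - g x) - m); last by rewrite /f'; ring.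
  by rewrite (le_trans (ler_normB _ _))// mulr_natl mulr2n lerD.
have fe x : Omega x -> `|f x - f 0| <= 8 * e.
  rewrite /Omega/= in_itv/= => /andP[xl xr].
  have x4 : `|x| <= 4 by rewrite ler_norml; lra.
  have := derive_lipschitz R f f' (2 * e) df f'e 0 x; rewrite subr0; nra.
have L1 : L (fun=> 1) (fun=> 0) = 0.
  rewrite -[RHS](Lcos 0%N); apply: eq_Rintegral => x _.
  by rewrite !mul0r cos0 oppr0.
have -> : L psi g = L (fun x => f 0 - f x) (fun x => - f' x).
  rewrite [RHS](_ : _ = L ((fun x => -1 * t x) \+ (psi \+ (fun x => f 0 * 1)))
                          ((fun x => -1 * (T x - m)) \+ (g \+ (fun x => f 0 * 0)))).
    have cTm : continuous (fun x => T x - m) by apply: ctsB => //; exact: cts_cst.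
    have cc c : continuous (fun _ : R => c : R) by exact: cts_cst.
    rewrite LD.
    - rewrite LD ?LZ ?Lt ?L1 ?mulr0 ?addr0 ?add0r//; exact: cc.
    - by apply: ctsM.
    - by apply: ctsM.
    - by apply: ctsD => //; exact: cc.
    - by apply: ctsD => //; exact: cc.
  by congr (L _ _); apply/funext => x /=; rewrite /f' /f; ring.
have cf := cts_derive R _ _ df.
have cf' : continuous f'.
  by apply: ctsB => //; apply: ctsB => //; exact: cts_cst.
have i1 : mu.-integrable Omega (EFin \o (fun x => A x * - f' x + B x * (f 0 - f x))).
  by apply: iL; [apply: ctsB => //; exact: cts_cst|exact: ctsN].
rewrite /L (le_trans (le_normr_Rintegral mO i1))//.
have nA := integrable_norm iA; have nB := integrable_norm iB.
apply: (@le_trans _ _ (\int[mu]_(x in Omega) (2 * e * `|A x| + 8 * e * `|B x|))).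
  apply: le_Rintegral => //.
  - exact: integrable_norm i1.
  - by apply: integrable_EFinD => //; exact: integrable_EFinZ.
  - move=> x Ox; rewrite (le_trans (ler_normD _ _))// !normrM normrN (distrC (f 0)).
    by rewrite (mulrC `|A x|) (mulrC `|B x|) lerD// ler_wpM2r// fe.
rewrite RintegralD//; [|exact: integrable_EFinZ|exact: integrable_EFinZ].
by rewrite !RintegralZl// /C mulrDr !mulrA (mulrC e 2) (mulrC e 8).
Qed.

End trigonometric_tests.

(** * Periodic bumps of class C1 *)

(** Comparison of difference quotients at a common zero; it covers the points where
    truncated squares and real powers are flat. *)
Lemma is_derive0_squeeze (R : realType) (f g : R -> R) (x : R) :
  is_derive x 1 g 0 -> f x = 0 -> g x = 0 -> (\near x, `|f x| <= `|g x|) ->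
  is_derive x 1 f 0.
Proof.
move=> [dg Dg] fx gx fg.
have qg : (fun h => h^-1 *: (g (h *: (1 : R) + x) - g x)) @ (0 : R)^' --> (0 : R).
  by rewrite -[X in _ --> X]Dg; exact: dg.
suff qf : (fun h => h^-1 *: (f (h *: (1 : R) + x) - f x)) @ (0 : R)^' --> (0 : R).
  by apply: DeriveDef; [apply/cvg_ex; exists 0|exact/cvg_lim].
have nearh : \forall h \near (0 : R)^', `|f (h *: (1 : R) + x)| <= `|g (h *: (1 : R) + x)|.
  have c0 : (fun h : R => h *: (1 : R) + x) @ (0 : R) --> x.
    have /(_ (0 : R)) := ctsD R _ _ (ctsM R _ _ (cts_id R) (cts_cst R 1)) (cts_cst R x).
    by rewrite /continuous_at mul0r add0r.
  by have := c0 _ fg; exact: nbhs_dnbhs.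
apply/cvgrPdist_le => e e0.
move/cvgrPdist_le : qg => /(_ e e0) qg.
near=> h.
have h1 : `|0 - h^-1 *: (g (h *: (1 : R) + x) - g x)| <= e by near: h; exact: qg.
have h2 : `|f (h *: (1 : R) + x)| <= `|g (h *: (1 : R) + x)| by near: h; exact: nearh.
rewrite !sub0r !normrN fx gx !subr0 !normrZ in h1 *.
by apply: le_trans h1; rewrite ler_wpM2l.
Unshelve. all: by end_near. Qed.

Section step.
Context (R : realType).
Implicit Types t s m r d x : R.

Definition sqpos t : R := Num.max 0 t ^+ 2.

Lemma is_derive_sqpos t : is_derive t 1 sqpos (2 * Num.max 0 t).
Proof.
have [t0|t0|t0] := ltgtP t 0.
- apply: (@near_eq_is_derive _ _ _ (cst 0)); last first.
    by rewrite mulr0; exact: is_derive_cst.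
  near=> s; rewrite /sqpos max_l ?expr0n//.
  by apply/ltW; near: s; exact: (cvgr_lt _ (cts_id R t)).
- apply: (@near_eq_is_derive _ _ _ (fun s => s ^+ 2)).
    near=> s; rewrite /sqpos max_r//.
    by apply/ltW; near: s; exact: (cvgr_gt _ (cts_id R t)).
  apply: is_derive_eq; rewrite /GRing.scale/=; ring.
- rewrite t0 mulr0; apply: (@is_derive0_squeeze _ _ (fun s => s ^+ 2)).
  + by apply: is_derive_eq; rewrite /GRing.scale/=; ring.
  + by rewrite /sqpos maxxx expr0n.
  + by rewrite expr0n.
  + near=> s; rewrite /sqpos normrX [leRHS]normrX ler_pXn2r ?nnegrE//.
    by have [s0|s0] := leP 0 s; rewrite ?normr0.
Unshelve. all: by end_near. Qed.

(** A transition of class C1 from 0 on [t <= 0] to 1 on [1 <= t], obtained from two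
    truncated squares. *)
Definition step t : R := 1 - sqpos (1 - sqpos t).
Definition step' t : R := 4 * Num.max 0 (1 - sqpos t) * Num.max 0 t.

Lemma is_derive_step t : is_derive t 1 step (step' t).
Proof.
have d1 := is_derive_sqpos t.
have d2 := is_derive_sqpos (1 - sqpos t).
have d3 : is_derive t 1 (fun s => 1 - sqpos s) (- (2 * Num.max 0 t)).
  by apply: (is_derive_eq (is_deriveB (is_derive_cst (1 : R) t 1) d1)); rewrite sub0r.
have d4 := @is_derive1_comp R sqpos (fun s => 1 - sqpos s) t _ _ d2 d3.
have d5 := is_deriveB (is_derive_cst (1 : R) t 1) d4.
by apply: (is_derive_eq d5); rewrite /step'; ring.
Qed.

Lemma continuous_max0 : continuous (fun t => Num.max 0 t).
Proof. by move=> x; apply: (@continuous_max R R (cst 0) id); [exact: cst_continuous|exact: cvg_id]. Qed.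

Lemma continuous_step' : continuous step'.
Proof.
have c0 := continuous_max0.
have c1 : continuous (fun t => 1 - sqpos t).
  by apply: ctsB; [exact: cts_cst|exact: ctsM].
apply: ctsM => //; apply: ctsM; first exact: cts_cst.
exact: (cts_comp _ (fun t => 1 - sqpos t)).
Qed.

Lemma step_bounds t : 0 <= step t <= 1.
Proof.
rewrite /step /sqpos; move: (Num.max 0 t ^+ 2) (sqr_ge0 (Num.max 0 t)) => p p0.
by have [h|h] := leP 0 (1 - p); apply/andP; split; nra.
Qed.

Lemma step'_bounds t : 0 <= step' t <= 4.
Proof.
rewrite /step' /sqpos.
have [t0|t0] := leP t 0; first by rewrite mulr0 lexx ler0n.
have [t1|t1] := leP (1 - t ^+ 2) 0; first by rewrite mulr0 mul0r lexx ler0n.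
by apply/andP; split; nra.
Qed.

Lemma step_le0 t : t <= 0 -> step t = 0 /\ step' t = 0.
Proof.
move=> t0; rewrite /step /step' /sqpos (max_l t0) expr0n subr0 mulr0.
by rewrite max_r// expr1n subrr.
Qed.

Lemma step_ge1 t : 1 <= t -> step t = 1 /\ step' t = 0.
Proof.
move=> t1; rewrite /step /step' /sqpos (max_r (le_trans ler01 t1)).
by rewrite (_ : Num.max 0 (1 - t ^+ 2) = 0) ?expr0n ?subr0 ?mulr0 ?mul0r//; apply: max_l; nra.
Qed.

End step.

Section trigonometric_inequalities.
Context (R : realType).
Implicit Types t s m r d x : R.

Lemma norm_sin_le t : `|sin t| <= `|t|.
Proof.
have := derive_lipschitz R sin cos 1 (@is_derive_sin R) (@cos_max R) 0 t.
by rewrite sin0 !subr0 mul1r.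
Qed.

Lemma cos_lt_out r t : 0 <= r < pi -> r < `|t| < pi *+ 2 - r -> cos t < cos r.
Proof.
move=> /andP[r0 rpi] /andP[rt tr]; rewrite -(cos_norm t).
have [tp|tp] := leP `|t| pi.
  by rewrite ltr_cos ?in_itv/= ?r0 ?(ltW rpi) ?normr_ge0.
rewrite -cosN -(cosD2pi (- `|t|)) ltr_cos ?in_itv/= ?r0 ?(ltW rpi)//; first by lra.
by apply/andP; split; lra.
Qed.

(** The mean value theorem, for [cos] on [[r / 2, r]] and then for [sin], whose
    derivative is at least [cos 1] on [[0, 1]]. *)
Lemma cos_half_gap r : 0 < r <= 1 -> cos (1 : R) * r ^+ 2 <= 4 * (cos (r / 2) - cos r).
Proof.
move=> /andP[r0 r1].
have c1 := @cos1_gt0 R.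
have cosge (z : R) : 0 <= z <= 1 -> cos 1 <= cos z.
  move=> /andP[z0]; rewrite le_eqVlt => /orP[/eqP->//|z1].
  by apply/ltW; rewrite ltr_cos// in_itv/= ?z0 ?ler01/=; have := pi_ge2 R; lra.
have sinlow (z : R) : 0 < z <= 1 -> cos 1 * z <= sin z.
  move=> /andP[z0 z1].
  have [|c] := @MVT R sin cos 0 z z0 (fun y _ => is_derive_sin y).
    exact/continuous_subspaceT/continuous_sin.
  rewrite in_itv/= sin0 !subr0 => /andP[c0 cz] ->.
  by rewrite ler_wpM2r ?(ltW z0)// cosge//; lra.
have [||c] := @MVT R cos (fun z => - sin z) (r / 2) r.
- lra.
- exact/continuous_subspaceT/continuous_cos.
rewrite in_itv/= => /andP[cl cr] e.
have sc : cos 1 * (r / 2) <= sin c.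
  by apply: (le_trans _ (sinlow c _)); [rewrite ler_pM2l// ltW|lra].
have -> : cos (r / 2) - cos r = sin c * (r / 2) by rewrite -[LHS]opprB e; field.
have -> : cos 1 * r ^+ 2 = 4 * (cos 1 * (r / 2) * (r / 2)) :> R by field.
by rewrite ler_pM2l ?ltr0n// ler_wpM2r//; lra.
Qed.

End trigonometric_inequalities.

Section bump.
Context (R : realType).
Implicit Types (s m r d x : R).

(** The bump is a function of [cos (s - m)], which makes it periodic without any
    periodic extension. Modulo [2 pi] it is supported on [|s - m| <= r] and equal
    to 1 on [|s - m| <= r - d]. *)
Definition bump_arg m r d s : R := (cos (s - m) - cos r) / (cos (r - d) - cos r).
Definition bump m r d s : R := step R (bump_arg m r d s).
Definition bump' m r d s : R :=
  step' R (bump_arg m r d s) * (- sin (s - m) / (cos (r - d) - cos r)).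

Lemma is_derive_bump m r d s : is_derive s 1 (bump m r d) (bump' m r d s).
Proof.
apply: (@is_derive1_comp _ (step R) (bump_arg m r d)); first exact: is_derive_step.
have ds : is_derive s 1 (fun s => s - m) 1.
  by apply: is_derive_eq; rewrite subr0.
have dc := @is_derive1_comp R cos (fun s => s - m) s _ _ (is_derive_cos (s - m)) ds.
have dd := is_deriveB dc (is_derive_cst (cos r) s 1).
rewrite [X in is_derive _ _ X _](_ : _ =
   (cos (r - d) - cos r)^-1 \*: ((cos \o (fun s => s - m)) - cst (cos r))).
  by apply: is_derive_eq; rewrite subr0 mulr1 /GRing.scale/= mulrC.
by apply/funext => y /=; rewrite /bump_arg mulrC.
Qed.

Lemma continuous_bump_arg m r d : continuous (bump_arg m r d).
Proof.
apply: ctsM; last exact: cts_cst.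
apply: ctsB; last exact: cts_cst.
apply: (cts_comp _ (fun y => y - m) cos); last exact: continuous_cos.
by apply: ctsB; [exact: cts_id|exact: cts_cst].
Qed.

Lemma continuous_bump' m r d : continuous (bump' m r d).
Proof.
apply: ctsM.
  apply: (cts_comp _ (bump_arg m r d) (step' R)).
    exact: continuous_bump_arg.
  exact: continuous_step'.
apply: ctsM; last exact: cts_cst.
apply: ctsN.
apply: (cts_comp _ (fun y => y - m) sin); last exact: continuous_sin.
by apply: ctsB; [exact: cts_id|exact: cts_cst].
Qed.

Lemma bump_periodic m r d : periodic (bump m r d) (pi *+ 2).
Proof.
by move=> s; rewrite /bump /bump_arg (_ : s + pi *+ 2 - m = s - m + pi *+ 2) ?cosD2pi//; ring.
Qed.

Lemma bump_bounds m r d s : 0 <= bump m r d s <= 1.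
Proof. exact: step_bounds. Qed.

Variables (m r d : R).
Hypothesis rd : 0 < d <= r /\ r < pi.

Lemma bump_gap : 0 < cos (r - d) - cos r.
Proof.
by have [/andP[d0 dr] rpi] := rd; rewrite subr_gt0 ltr_cos// ?in_itv/=; lra.
Qed.

Lemma bump_out s : cos (s - m) <= cos r -> bump m r d s = 0 /\ bump' m r d s = 0.
Proof.
move=> h; have [|h1 h2] := step_le0 R (bump_arg m r d s).
  by rewrite ler_pdivrMr ?bump_gap// mul0r subr_le0.
by rewrite /bump /bump' h1 h2 mul0r.
Qed.

Lemma bump_plateau s : `|s - m| <= r - d -> bump m r d s = 1 /\ bump' m r d s = 0.
Proof.
move=> h; have [|h1 h2] := step_ge1 R (bump_arg m r d s).
  rewrite ler_pdivlMr ?bump_gap// mul1r lerD2r -(cos_norm (s - m)).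
  move: h; rewrite le_eqVlt => /orP[/eqP->//|h].
  have [/andP[d0 dr] rpi] := rd.
  by apply/ltW; rewrite ltr_cos// in_itv/= ?normr_ge0/=; lra.
by rewrite /bump /bump' h1 h2 mul0r.
Qed.

Lemma bump'_ge0 s : m - r <= s <= m -> 0 <= bump' m r d s.
Proof.
move=> /andP[sl sr].
have [/andP[d0 dr] rpi] := rd.
rewrite mulr_ge0 ?(andP (step'_bounds _ _)).1// divr_ge0 ?(ltW bump_gap)//.
by rewrite -sinN sin_ge0_pi//; lra.
Qed.

Lemma bump'_le0 s : m <= s <= m + r -> bump' m r d s <= 0.
Proof.
move=> /andP[sl sr].
have [/andP[d0 dr] rpi] := rd.
rewrite mulr_ge0_le0 ?(andP (step'_bounds _ _)).1// mulNr oppr_le0 divr_ge0 ?(ltW bump_gap)//.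
by rewrite sin_ge0_pi//; lra.
Qed.

Lemma norm_bump'_le s : `|s - m| <= r ->
  `|bump' m r d s| <= 4 * r / (cos (r - d) - cos r).
Proof.
move=> h; have g0 := bump_gap.
rewrite /bump' normrM (ger0_norm (andP (step'_bounds _ _)).1) normrM normfV normrN (gtr0_norm g0) mulrA ler_pM2r ?invr_gt0//.
have /andP[s0 s4] := step'_bounds R (bump_arg m r d s).
by apply: ler_pM => //; exact: le_trans (norm_sin_le _ _) h.
Qed.

(** As [[m - r, m + r]] lies inside the period, points of the period are at distance
    less than [2 pi - r] from [m], so that only one copy of the support is met. *)
Lemma bump_support s : - pi <= m - r -> m + r < pi -> Omega s ->
  ~~ (m - r <= s <= m + r) -> cos (s - m) < cos r.
Proof.
move=> ml mr; rewrite /Omega/= in_itv/= => /andP[sl sr] h.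
have [/andP[d0 dr] rpi] := rd.
apply: cos_lt_out; first by lra.
by move: h; rewrite negb_and -!ltNge => /orP[h|h];
  have [h0|h0] := ger0P (s - m); lra.
Qed.

End bump.

(** * Smooth test functions and square integrable functions *)

Section trigonometric_test_functions.
Context (R : realType).
Implicit Types (a b x : R) (k : nat).

Lemma is_derive_trig a b k x :
  is_derive x 1 (fun x => a * cos (k%:R * x) + b * sin (k%:R * x))
    ((b * k%:R) * cos (k%:R * x) + (- (a * k%:R)) * sin (k%:R * x)).
Proof. by apply: is_derive_eq; rewrite /GRing.scale/=; ring. Qed.

Lemma derive1_trig a b k :
  (fun x => a * cos (k%:R * x) + b * sin (k%:R * x))^`()%classic =
  (fun x => (b * k%:R) * cos (k%:R * x) + (- (a * k%:R)) * sin (k%:R * x)).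
Proof.
by apply/funext => x; rewrite derive1E; have [_ ->] := is_derive_trig a b k x.
Qed.

Lemma Cinf_per_trig a b k :
  Cinf_per (fun x => a * cos (k%:R * x) + b * sin (k%:R * x)).
Proof.
split=> [x|j x].
  rewrite mulrDr mulr_natl [k%:R * (pi *+ 2)]mulr_natl.
  by rewrite (periodicn (@cosD2pi R)) (periodicn (@sinD2pi R)).
suff [a' [b' ->]] : exists a' b',
    derive1n j (fun x => a * cos (k%:R * x) + b * sin (k%:R * x)) =
    (fun x => a' * cos (k%:R * x) + b' * sin (k%:R * x)).
  by have [] := is_derive_trig a' b' k x.
elim: j => [|j [a' [b' IH]]]; first by exists a, b.
by rewrite derive1nS IH derive1_trig; do 2 eexists.
Qed.

End trigonometric_test_functions.

Section square_integrable.
Context (R : realType).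
Notation mu := (@lebesgue_measure R).
Variable v : R -> R.
Hypothesis vL2 : L2_Omega v.

Lemma L2_Omega_integrable : mu.-integrable Omega (EFin \o v).
Proof.
have [mv iv2] := vL2; have mO := measurable_Omega R.
have i1 : mu.-integrable Omega (EFin \o (fun x => 1 + v x ^+ 2)).
  by apply: integrable_EFinD => //; apply: integrable_Omega_continuous; exact: cts_cst.
apply: (le_integrable mO _ _ i1); first exact/measurable_realfun.measurable_EFinP.
move=> x _ /=; rewrite lee_fin [leRHS]ger0_norm ?addr_ge0 ?sqr_ge0//.
by have [h|h] := ger0P (v x); nra.
Qed.

Lemma itv_sub_Omega (a b : R) : - pi <= a -> b < pi -> `[a, b] `<=` @Omega R.
Proof.
move=> ha hb x; rewrite /Omega/= !in_itv/= => /andP[ax xb].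
by rewrite (le_trans ha ax) (le_lt_trans xb hb).
Qed.

(** Pointwise [2 |v| <= t v ^ 2 + 1 / t]; with the free parameter [t] this does the
    work of the Cauchy-Schwarz inequality. *)
Lemma Rintegral_AMGM (a b t : R) : - pi <= a -> b < pi -> a <= b -> 0 < t ->
  \int[mu]_(x in `[a, b]) `|v x| <=
  (t * \int[mu]_(x in `[a, b]) (v x ^+ 2) + (b - a) / t) / 2.
Proof.
move=> ha hb ab t0; have [mv iv2] := vL2; have mO := measurable_Omega R.
have sub := itv_sub_Omega a b ha hb.
have mI : measurable (`[a, b]%classic : set (measurableTypeR R)) by exact: measurable_itv.
have iv : mu.-integrable `[a, b] (EFin \o v).
  by apply: (integrableS mO mI sub); exact: L2_Omega_integrable.
have ivv : mu.-integrable `[a, b] (EFin \o (fun x => v x ^+ 2)).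
  exact: (integrableS mO mI sub).
have ic : mu.-integrable `[a, b] (EFin \o (fun x : R => 1 / (2 * t))).
  apply: (@integrable_continuous _ (fun=> 1 / (2 * t)) _ a b) => //; exact: cts_cst.
apply: (@le_trans _ _ (\int[mu]_(x in `[a, b]) (t / 2 * v x ^+ 2 + 1 / (2 * t)))).
  apply: le_Rintegral => //.
  - exact: integrable_norm.
  - by apply: integrable_EFinD => //; exact: integrable_EFinZ.
  - move=> x _; rewrite -subr_ge0.
    have -> : t / 2 * v x ^+ 2 + 1 / (2 * t) - `|v x| = (t * `|v x| - 1) ^+ 2 / (2 * t).
      by rewrite -(real_normK (num_real (v x))); field; rewrite lt0r_neq0.
    by rewrite divr_ge0 ?sqr_ge0// mulr_ge0// ltW.
rewrite RintegralD//; last exact: integrable_EFinZ.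
have := lebesgue_measure_itv `[a, b].
rewrite RintegralZl// Rintegral_cst//= lte_fin => ->.
move: (Rintegral _ _ _) => I.
have [lt|ge] := ltP a b; last first.
  have -> : a = b by apply/le_anti; rewrite ab.
  by rewrite /= mulr0 subrr mul0r; lra.
rewrite le_eqVlt; apply/orP; left; apply/eqP; rewrite /=; field.
by rewrite lt0r_neq0.
Qed.

End square_integrable.

Section interval_integrals.
Context (R : realType).
Notation mu := (@lebesgue_measure R).

Lemma Rintegral_support (D E : set R) (f : R -> R) :
  D `<=` E -> (forall x, E x -> ~ D x -> f x = 0) ->
  \int[mu]_(x in E) f x = \int[mu]_(x in D) f x.
Proof.
move=> DE f0; rewrite -[in RHS](setIidr DE) Rintegral_mkcondr.
apply: eq_Rintegral => x /set_mem Ex; rewrite patchE.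
by case: ifPn => // /negP xD; apply: f0 => // Dx; apply: xD; exact: mem_set.
Qed.

Lemma Rintegral_subset (D E : set R) (f : R -> R) :
  measurable (D : set (measurableTypeR R)) -> measurable (E : set (measurableTypeR R)) ->
  D `<=` E -> (forall x, E x -> 0 <= f x) -> mu.-integrable E (EFin \o f) ->
  \int[mu]_(x in D) f x <= \int[mu]_(x in E) f x.
Proof.
move=> mD mE DE f0 fi; rewrite -[in leLHS](setIidr DE) Rintegral_mkcondr.
apply: le_Rintegral => //.
  rewrite -restrict_EFin; apply/(@integrable_restrict _ _ _ mu) => //.
  by rewrite setIidr//; exact: integrableS fi.
by move=> x Ex; rewrite patchE; case: ifP => // _; exact: f0.
Qed.

Lemma Rintegral_split (f : R -> R) (a m b : R) : a <= m -> m <= b ->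
  mu.-integrable `[a, b] (EFin \o f) ->
  \int[mu]_(x in `[a, b]) f x =
  \int[mu]_(x in `[a, m]) f x + \int[mu]_(x in `[m, b]) f x.
Proof.
move=> am mb fi.
have := @Rintegral_itvB _ f (BLeft a) (BRight b) m fi.
rewrite !bnd_simp => /(_ am mb) h.
rewrite -[X in _ + X]Rintegral_itv_obnd_cbnd; first by rewrite -[X in _ + X]h addrC subrK.
apply: (@integrableS _ _ R mu _ _ _ _ _ _ fi) => //.
by apply: subset_itv; rewrite bnd_simp.
Qed.

End interval_integrals.

(** * Growth of an H2 function at a double zero *)

Section second_derivative.
Context (R : realType).
Notation mu := (@lebesgue_measure R).
Variables (u u' w : R -> R).
Hypotheses (up : periodic u (pi *+ 2))
  (du : forall x : R, is_derive x (1 : R) u (u' x)) (cu' : continuous u')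
  (wd : weak_deriv 2 u w).

Let cu : continuous u := cts_derive R u u' du.
Let iw : mu.-integrable Omega (EFin \o w) := L2_Omega_integrable R w wd.1.

Let by_parts (a b : R) (k : nat) :
  let phi := fun x : R => a * cos (k%:R * x) + b * sin (k%:R * x) in
  let phi' := fun x => (b * k%:R) * cos (k%:R * x) + (- (a * k%:R)) * sin (k%:R * x) in
  \int[mu]_(x in Omega) (u' x * phi' x + w x * phi x) = 0.
Proof.
move=> phi phi'.
pose phi'' := fun x => ((- (a * k%:R)) * k%:R) * cos (k%:R * x) + (- (b * k%:R * k%:R)) * sin (k%:R * x).
have d1 (x : R) : is_derive x (1 : R) phi (phi' x) by exact: is_derive_trig.
have d2 (x : R) : is_derive x (1 : R) phi' (phi'' x) by exact: is_derive_trig.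
have d3 (x : R) : is_derive x (1 : R) phi'' (((- (b * k%:R * k%:R)) * k%:R) * cos (k%:R * x) + (- ((- (a * k%:R)) * k%:R * k%:R)) * sin (k%:R * x)).
  exact: is_derive_trig.
have cphi := cts_derive R _ _ d1; have cphi' := cts_derive R _ _ d2.
have cphi'' := cts_derive R _ _ d3.
have mO := measurable_Omega R.
have iu : mu.-integrable Omega (EFin \o u) by exact: integrable_Omega_continuous.
have iu' : mu.-integrable Omega (EFin \o u') by exact: integrable_Omega_continuous.
have [_ /(_ phi (Cinf_per_trig R a b k))] := wd.
rewrite derive1nS derive1n1 derive1_trig derive1_trig -/phi'' sqrrN expr1n mul1r => hw.
have := Rintegral_Omega_derive R (fun x => u x * phi' x)
  (fun x => u x * phi'' x + u' x * phi' x).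
rewrite RintegralD//; [|exact: integrable_Omega_mul|exact: integrable_Omega_mul].
rewrite RintegralD//; [|exact: integrable_Omega_mul|exact: integrable_Omega_mul].
rewrite hw addrC; apply.
- move=> x; rewrite up; congr (_ * _).
  by have [h _] := Cinf_per_trig R (b * k%:R) (- (a * k%:R)) k; exact: h.
- by move=> x; apply: is_derive_eq; rewrite /GRing.scale/=; ring.
- by apply: ctsD; exact: ctsM.
Qed.

(** One integration by parts of the definition of [w] uses that [u] is of class C1;
    after it, only first derivatives of the test function occur. *)
Lemma weak_deriv2_C1_test (psi g : R -> R) : periodic psi (pi *+ 2) ->
  (forall x : R, is_derive x (1 : R) psi (g x)) -> continuous g ->
  \int[mu]_(x in Omega) (u' x * g x + w x * psi x) = 0.
Proof.
apply: periodic_C1_test => // [|k|k]; first exact: integrable_Omega_continuous.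
- rewrite -[RHS](by_parts 1 0 k); apply: eq_Rintegral => x _ /=; ring.
- rewrite -[RHS](by_parts 0 1 k); apply: eq_Rintegral => x _ /=; ring.
Qed.

(** Test with a bump [b] on [[x, y]] that rises from 0 to 1 next to [x] and falls
    back next to [y]: by continuity of [u'], the integral of [u' b'] is close to
    [u' x - u' y], while that of [w b] is at most the integral of [|w|]. *)
Lemma derive_increment_le (x y : R) : - pi <= x -> x < y -> y < pi ->
  u' y - u' x <= \int[mu]_(s in `[x, y]) `|w s|.
Proof.
move=> xl xy yr; apply/ler_addgt0Pr => e0 e00.
pose e := e0 / 2; have e_gt0 : 0 < e by rewrite divr_gt0.
have /cvgrPdist_lt /(_ e e_gt0) [dx /= dx0 hx] := cu' x.
have /cvgrPdist_lt /(_ e e_gt0) [dy /= dy0 hy] := cu' y.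
(* The bump varies only within distance [d] of the end points, where [u'] is
   within [e] of its value there. *)
pose m := (x + y) / 2; pose r := (y - x) / 2.
pose d := Num.min r (Num.min dx dy / 2).
have d0 : 0 < d by rewrite /d !lt_min !divr_gt0 ?lt_min ?dx0 ?dy0//; lra.
have dr : d <= r by rewrite /d ge_min lexx.
have [ddx ddy] : d < dx /\ d < dy.
  have : d <= Num.min dx dy / 2 by rewrite /d ge_min lexx orbT.
  have : Num.min dx dy <= dx by rewrite ge_min lexx.
  have : Num.min dx dy <= dy by rewrite ge_min lexx orbT.
  by lra.
have rd : 0 < d <= r /\ r < pi by rewrite d0 dr /r; lra.
pose b := bump R m r d; pose b' := bump' R m r d.
have db (s : R) : is_derive s (1 : R) b (b' s) by exact: is_derive_bump.
have cb' : continuous b' by exact: continuous_bump'.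
have cb := cts_derive R _ _ db.
have mx : m - r = x by rewrite /m /r; field.
have my : m + r = y by rewrite /m /r; field.
have := weak_deriv2_C1_test b b' (bump_periodic R m r d) db cb'.
have sub := itv_sub_Omega R x y xl yr.
rewrite (Rintegral_support R _ _ _ sub) => [|s Os xys]; last first.
  have [|e1 e2] := bump_out R m r d rd s; last by rewrite /b /b' e1 e2 !mulr0 addr0.
  apply/ltW; apply: (bump_support R m r d rd) => //; rewrite ?mx ?my//.
  by apply/negP => h; apply: xys; rewrite /= in_itv.
have icts f a c : continuous f -> mu.-integrable `[a, c] (EFin \o f).
  by move=> cf; exact: (integrable_continuous R f _ a c).
have mI a c : measurable (`[a, c]%classic : set (measurableTypeR R)) by exact: measurable_itv.
have iwI : mu.-integrable `[x, y] (EFin \o w).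
  exact: (integrableS (measurable_Omega R) (mI _ _) sub).
have iwb : mu.-integrable `[x, y] (EFin \o (fun s => w s * b s)).
  exact: (integrable_mul_continuous R w b _ x y).
have iub : mu.-integrable `[x, y] (EFin \o (fun s => u' s * b' s)).
  by apply: icts; exact: ctsM.
have xm : x <= m by rewrite /m; lra.
have my' : m <= y by rewrite /m; lra.
rewrite RintegralD// (Rintegral_split R _ x m y)//.
have [bm _] : b m = 1 /\ b' m = 0.
  by apply: (bump_plateau R m r d rd); rewrite subrr normr0; lra.
have [bx _] : b x = 0 /\ b' x = 0.
  by apply: (bump_out R m r d rd); rewrite -cosN (_ : - (x - m) = r)// -mx; ring.
have [by_ _] : b y = 0 /\ b' y = 0.
  by apply: (bump_out R m r d rd); rewrite (_ : y - m = r)// -my; ring.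
have left_le : \int[mu]_(s in `[x, m]) (u' s * b' s) <= u' x + e.
  have -> : u' x + e = \int[mu]_(s in `[x, m]) ((u' x + e) * b' s).
    rewrite RintegralZl//; last exact: icts.
    by rewrite (Rintegral_derive R b)// bm bx subr0 mulr1.
  apply: le_Rintegral => //; first by apply: icts; exact: ctsM.
    by apply: icts; apply: ctsM => //; exact: cts_cst.
  move=> s; rewrite /= in_itv/= => /andP[xs sm].
  have b'0 : 0 <= b' s by apply: (bump'_ge0 R m r d rd); rewrite mx xs.
  have [h|h] := leP `|s - m| (r - d).
    by have [_ e1] := bump_plateau R m r d rd s h; rewrite /b' e1 !mulr0.
  rewrite ler_wpM2r//; have := hx s.
  have sx : `|x - s| < dx by rewrite ltr_norml; move: h; rewrite ler0_norm; lra.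
  by move=> /(_ sx); rewrite ltr_norml; lra.
have right_le : \int[mu]_(s in `[m, y]) (u' s * b' s) <= - (u' y - e).
  have -> : - (u' y - e) = \int[mu]_(s in `[m, y]) ((u' y - e) * b' s).
    rewrite RintegralZl//; last exact: icts.
    by rewrite (Rintegral_derive R b)// bm by_ sub0r mulrN1.
  apply: le_Rintegral => //; first by apply: icts; exact: ctsM.
    by apply: icts; apply: ctsM => //; exact: cts_cst.
  move=> s; rewrite /= in_itv/= => /andP[ms sy].
  have b'0 : b' s <= 0 by apply: (bump'_le0 R m r d rd); rewrite my ms.
  have [h|h] := leP `|s - m| (r - d).
    by have [_ e1] := bump_plateau R m r d rd s h; rewrite /b' e1 !mulr0.
  rewrite ler_wnM2r//; have := hy s.
  have sx : `|y - s| < dy by rewrite ltr_norml; move: h; rewrite ger0_norm; lra.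
  by move=> /(_ sx); rewrite ltr_norml; lra.
have wle : \int[mu]_(s in `[x, y]) (w s * b s) <= \int[mu]_(s in `[x, y]) `|w s|.
  apply: (le_trans (ler_norm _)).
  apply: (le_trans (le_normr_Rintegral (mI x y) iwb)).
  apply: le_Rintegral => //; [exact: integrable_norm iwb|exact: integrable_norm iwI|].
  move=> s _; rewrite normrM ler_piMr//.
  by have /andP[b0 b1] := bump_bounds R m r d s; rewrite ger0_norm.
have e2 : e0 = e + e by rewrite /e; field.
rewrite e2; clearbody e.
move: left_le right_le wle; move: (Rintegral _ _ _) (Rintegral _ _ _).
by move=> I1 I2; move: (Rintegral _ _ _) (Rintegral _ _ _) => I3 I4; lra.
Qed.

(** By [derive_increment_le] and the choice [t = sqrt (s - a)] in [Rintegral_AMGM],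
    [u' s] is at most a multiple of [sqrt (s - a)]; integrate once more. *)
Lemma growth_at_zero (a : R) : - pi <= a -> u a = 0 -> u' a = 0 ->
  exists2 C, 0 < C & forall y, a < y < pi -> u y <= C * ((y - a) * Num.sqrt (y - a)).
Proof.
move=> al ua u'a.
pose W := \int[mu]_(x in Omega) (w x ^+ 2).
have mO := measurable_Omega R.
have W0 : 0 <= W by apply: Rintegral_ge0 => x _; exact: sqr_ge0.
exists ((W + 1) / 2) => [|y /andP[ay yp]]; first by rewrite divr_gt0// ltr_wpDl.
have u'le s : a < s <= y -> u' s <= (W + 1) / 2 * Num.sqrt (y - a).
  move=> /andP[as_ sy]; have sp : s < pi := le_lt_trans sy yp.
  have q0 : 0 < Num.sqrt (s - a) by rewrite sqrtr_gt0 subr_gt0.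
  have := derive_increment_le a s al as_ sp.
  rewrite u'a subr0 => /le_trans; apply.
  apply: (le_trans (Rintegral_AMGM R w wd.1 a s _ al sp (ltW as_) q0)).
  have -> : (s - a) / Num.sqrt (s - a) = Num.sqrt (s - a).
    by rewrite -[X in X / _]sqr_sqrtr ?subr_ge0 ?ltW// expr2 mulfK// lt0r_neq0.
  have W' : \int[mu]_(x in `[a, s]) (w x ^+ 2) <= W.
    apply: Rintegral_subset => //; last exact: wd.1.2.
      exact: itv_sub_Omega.
    by move=> x _; exact: sqr_ge0.
  have q1 : Num.sqrt (s - a) <= Num.sqrt (y - a) by rewrite ler_wsqrtr// lerD2r.
  by nra.
have [|c /[1!in_itv]/= /andP[ac cy]] := @MVT R u u' a y ay (fun x _ => du x).
  exact: continuous_subspaceT.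
rewrite ua subr0 => ->; rewrite mulrA mulrAC ler_pM2r ?subr_gt0//.
by apply: u'le; rewrite ac ltW.
Qed.

End second_derivative.

(** * Powers of a nonnegative function and its zeros *)

Lemma derive_at_zero (R : realType) (f f' : R -> R) (x : R) :
  (forall y : R, is_derive y (1 : R) f (f' y)) -> (forall y, 0 <= f y) ->
  f x = 0 -> f' x = 0.
Proof.
move=> df f0 fx.
have [||||_ <-] := @derive1_at_min R f (x - 1) (x + 1) x.
- lra.
- by move=> t _; have [] := df t.
- by rewrite in_itv/=; lra.
- by move=> t _; rewrite fx.
by have [_ <-] := df x.
Qed.

(** Where [f] vanishes, so does its derivative, and [f ^ p <= f] nearby. *)
Lemma is_derive_powR (R : realType) (f f' : R -> R) (p x : R) :
  (forall y : R, is_derive y (1 : R) f (f' y)) -> (forall y, 0 <= f y) -> 1 <= p ->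
  is_derive x 1 (fun y => f y `^ p) (p * f x `^ (p - 1) * f' x).
Proof.
move=> df f0 p1.
have := f0 x; rewrite le_eqVlt => /orP[/eqP fx|fx].
  have f'x := derive_at_zero R f f' x df f0 (esym fx).
  rewrite f'x mulr0; apply: (@is_derive0_squeeze R _ f).
  - by rewrite -f'x; exact: df.
  - by rewrite -fx powR0//; lra.
  - by rewrite -fx.
  - have cf := cts_derive R _ _ df.
    near=> y; rewrite !ger0_norm ?powR_ge0//.
    have := f0 y; rewrite le_eqVlt => /orP[/eqP<-|fy]; first by rewrite powR0//; lra.
    apply: ge1r_powR => //; rewrite fy/=; near: y.
    have := cvgr_lt _ (cf x); rewrite -fx => /(_ _ 1 ltr01).
    by apply: filterS => y /ltW.
exact: (@is_derive1_comp R (fun y => y `^ p) f x _ _ (is_derive1_powR p fx) (df x)).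
Unshelve. all: by end_near. Qed.

Lemma is_derive_powR_gt0 (R : realType) (f f' : R -> R) (p x : R) :
  is_derive x (1 : R) f (f' x) -> 0 < f x ->
  is_derive x 1 (fun y => f y `^ p) (p * f x `^ (p - 1) * f' x).
Proof.
move=> df fx.
exact: (@is_derive1_comp R (fun y => y `^ p) f x _ _ (is_derive1_powR p fx) df).
Qed.

(** A translate of [p] by periods lies to the right of [z]; take the last zero before
    it, and bring that zero back to the period. *)
Lemma zero_with_positive_right (R : realType) (u : R -> R) (z p : R) :
  continuous u -> periodic u (pi *+ 2) -> (forall x, 0 <= u x) ->
  u z = 0 -> u p != 0 ->
  exists a d : R, [/\ - pi <= a, 0 < d, a + d < pi, u a = 0 &
    forall x, a < x < a + d -> 0 < u x].
Proof.
move=> cu up u0 uz up0.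
have [k] := period_reduction R (z + pi) p.
set p' := p + _ => /andP[h1 h2].
have up' : 0 < u p' by rewrite lt0r u0 andbT /p' (periodicz R u up).
have zp : z < p'.
  rewrite lt_neqAle (_ : z <= p'); last by lra.
  by rewrite andbT; apply: contraTneq up' => <-; rewrite uz ltxx.
pose Z := [set t | z <= t <= p' /\ u t = 0].
have Zz : Z z by split; [rewrite lexx ltW|].
have hZ : has_sup Z.
  by split; [exists z|exists p' => t [/andP[]]].
have Zub := sup_upper_bound hZ.
have za : z <= sup Z by exact: Zub.
have ap : sup Z <= p' by apply: ge_sup; [exists z|move=> t [/andP[]]].
set a := sup Z in Zub za ap *.
have ua : u a = 0.
  apply/eqP; apply: contraT => ua0.
  have uapos : 0 < u a by rewrite lt0r ua0 u0.
  have /cvgrPdist_lt /(_ _ uapos) [e /= e0 he] := cu a.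
  have [t [tp ut] at_] := sup_adherent e0 hZ.
  have := he t; rewrite ut subr0 (gtr0_norm uapos) ltxx; apply.
  by rewrite /ball_/= ger0_norm ?subr_ge0; [rewrite -/a in at_; lra|exact: Zub].
have ap' : a < p'.
  by rewrite lt_neqAle ap andbT; apply: contraTneq up' => <-; rewrite ua ltxx.
have upos x : a < x < p' -> 0 < u x.
  move=> /andP[ax xp]; rewrite lt0r u0 andbT; apply/negP => /eqP ux.
  by have := Zub x; rewrite leNgt ax => /(_ _)/negP; apply; split => //; lra.
have [l] := period_reduction R 0 a; rewrite subr0 => /andP[la lb].
set a0 := a + _ in la lb.
exists a0, (Num.min (p' - a) (pi - a0) / 2).
have mn : 0 < Num.min (p' - a) (pi - a0) by rewrite lt_min !subr_gt0 ap' lb.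
have m1 : Num.min (p' - a) (pi - a0) <= p' - a by rewrite ge_min lexx.
have m2 : Num.min (p' - a) (pi - a0) <= pi - a0 by rewrite ge_min lexx orbT.
split => //; [by rewrite divr_gt0|by lra|by rewrite /a0 (periodicz R u up)|].
move=> x /andP[ax xd].
rewrite -(periodicz R u up (- l) x); apply: upos; rewrite mulrNz mulNr.
by rewrite /a0 in ax xd mn m1 m2; apply/andP; split; lra.
Qed.

Lemma L2_Omega_add_continuous (R : realType) (v f : R -> R) :
  L2_Omega v -> continuous f -> L2_Omega (fun x => v x + f x).
Proof.
move=> vL cf; have [mv v2] := vL; have mO := measurable_Omega R; split.
  apply: measurable_realfun.measurable_funD => //.
  by apply: measurable_funTS; exact: measurable_realfun.continuous_measurable_fun.
rewrite (_ : (fun x => _) = EFin \o (fun x => v x ^+ 2 + v x * (2 * f x) + f x ^+ 2)).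
  apply: integrable_EFinD => //.
    apply: integrable_EFinD => //; apply: integrable_Omega_mul.
      by apply: ctsM => //; exact: cts_cst.
    exact: L2_Omega_integrable.
  by apply: integrable_Omega_continuous; exact: ctsM.
by apply/funext => x /=; congr EFin; ring.
Qed.

(** * The equation integrated once *)

Section once_integrated.
Context (R : realType).
Notation mu := (@lebesgue_measure R).
Variables (n omega : R) (u u' F : R -> R).
Hypotheses (hn : 2 <= n)
  (du : forall x : R, is_derive x (1 : R) u (u' x)) (cu' : continuous u')
  (u_ge0 : forall x, 0 <= u x) (FL2 : L2_Omega F).
Hypothesis hsol : forall phi : R -> R, Cinf_per phi ->
    \int[mu]_(x in Omega)
      ((fun y : R => (u y `^ n) * phi^`()%classic y)^`()%classic x * F x
       - omega * u x * phi^`()%classic x) = 0.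

Let cu : continuous u := cts_derive R u u' du.

Let n1 : 1 <= n. Proof. exact: le_trans (ler1n _ 2) hn. Qed.
Let nB1 : 1 <= n - 1. Proof. by rewrite lerBrDr. Qed.

Let mO := measurable_Omega R.

Let iF : mu.-integrable Omega (EFin \o F) := L2_Omega_integrable R F FL2.

Let cpow (p : R) : 1 <= p -> continuous (fun x => u x `^ p).
Proof. by move=> p1; apply: (cts_derive R) => x; exact: is_derive_powR. Qed.

Let A x := F x * u x `^ n.
Let B0 x := F x * (n * u x `^ (n - 1) * u' x) - omega * u x.
Let c := (\int[mu]_(x in Omega) B0 x) / (pi *+ 2).

Let iA : mu.-integrable Omega (EFin \o A).
Proof. by apply: integrable_Omega_mul => //; exact: cpow. Qed.

Let iB0 : mu.-integrable Omega (EFin \o B0).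
Proof.
apply: integrable_EFinB => //.
  apply: integrable_Omega_mul => //; apply: ctsM => //; apply: ctsM.
    exact: cts_cst.
  exact: cpow.
by apply: integrable_Omega_continuous; apply: ctsM => //; exact: cts_cst.
Qed.

Let icst (k : R) : mu.-integrable Omega (EFin \o (fun _ : R => k)).
Proof. by apply: integrable_Omega_continuous; exact: cts_cst. Qed.

Let iB : mu.-integrable Omega (EFin \o (fun x => B0 x - c)).
Proof. by apply: integrable_EFinB. Qed.

Let B_mean : \int[mu]_(x in Omega) (B0 x - c) = 0.
Proof.
rewrite RintegralB// Rintegral_cst//.
have := lebesgue_measure_itv `[(- pi)%R, (pi : R)[.
rewrite /= lte_fin gtrN ?pi_gt0// => ->.
rewrite /= opprK -mulr2n /c divfK ?subrr// mulrn_eq0/=.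
by rewrite lt0r_neq0// pi_gt0.
Qed.

Let trig_test (a b : R) (k : nat) :
  let phi' := fun x => (b * k%:R) * cos (k%:R * x) + (- (a * k%:R)) * sin (k%:R * x) in
  let phi'' := fun x => ((- (a * k%:R)) * k%:R) * cos (k%:R * x) + (- (b * k%:R * k%:R)) * sin (k%:R * x) in
  \int[mu]_(x in Omega) (A x * phi'' x + (B0 x - c) * phi' x) = 0.
Proof.
move=> phi' phi''.
have d1 (x : R) : is_derive x (1 : R) (fun x : R => a * cos (k%:R * x) + b * sin (k%:R * x)) (phi' x) by exact: is_derive_trig.
have d2 (x : R) : is_derive x (1 : R) phi' (phi'' x) by exact: is_derive_trig.
have d3 (x : R) : is_derive x (1 : R) phi'' (((- (b * k%:R * k%:R)) * k%:R) * cos (k%:R * x) + (- ((- (a * k%:R)) * k%:R * k%:R)) * sin (k%:R * x)).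
  exact: is_derive_trig.
have cphi' := cts_derive R _ _ d2; have cphi'' := cts_derive R _ _ d3.
have per := Cinf_per_trig R a b k.
have i0 : \int[mu]_(x in Omega) phi' x = 0.
  by apply: (Rintegral_Omega_derive R _ _ per.1 d1).
have := hsol _ per; rewrite derive1_trig -/phi' => h.
transitivity (\int[mu]_(x in Omega) (A x * phi'' x + B0 x * phi' x - c * phi' x)).
  by apply: eq_Rintegral => x _; rewrite mulrBl addrA.
rewrite RintegralB//; last 2 first.
- by apply: integrable_EFinD => //; exact: integrable_Omega_mul.
- by apply: integrable_EFinZ => //; exact: integrable_Omega_continuous.
rewrite RintegralZl//; last exact: integrable_Omega_continuous.
rewrite i0 mulr0 subr0 -[RHS]h; apply: eq_Rintegral => x _.
have dn := is_derive_powR R u u' n x du u_ge0 n1.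
rewrite derive1E; have [_ ->] := is_deriveM dn (d2 x).
by rewrite /A /B0 /GRing.scale/= -/(phi' x); ring.
Qed.

(** Writing [A = u ^ n F] and [B0 = n u ^ (n - 1) u' F - omega u], the weak
    equation says that the distribution [B0 - A'] annihilates every test function
    [phi'], that is, every test function of mean zero; it is therefore a constant,
    and testing with [1] shows that this constant is the mean [c] of [B0]. Once
    [c] is subtracted, constants are admissible tests as well, and
    [periodic_C1_test] applies. *)
Lemma exists_integration_constant : exists c : R,
  forall psi g : R -> R, periodic psi (pi *+ 2) ->
  (forall x : R, is_derive x (1 : R) psi (g x)) -> continuous g ->
  \int[mu]_(x in Omega) (F x * u x `^ n * g x +
    (F x * (n * u x `^ (n - 1) * u' x) - omega * u x - c) * psi x) = 0.
Proof.
exists c; apply: periodic_C1_test => // [[|k]|[|k]].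
- rewrite -[RHS]B_mean; apply: eq_Rintegral => x _.
  by rewrite !mul0r cos0 oppr0 mulr0 add0r mulr1.
- rewrite -[RHS](trig_test 0 k.+1%:R^-1 k.+1); apply: eq_Rintegral => x _; rewrite /A /B0 /=; field.
  by rewrite nat1r pnatr_eq0.
- rewrite -[RHS](trig_test 0 0 0); apply: eq_Rintegral => x _ /=.
  by rewrite !mul0r sin0; ring.
- rewrite -[RHS](trig_test (- k.+1%:R^-1) 0 k.+1); apply: eq_Rintegral => x _; rewrite /A /B0 /=; field.
  by rewrite nat1r pnatr_eq0.
Qed.

End once_integrated.

(** * The equation near the left end of a positivity interval *)

Section near_a_zero.
Context (R : realType).
Notation mu := (@lebesgue_measure R).
Variables (n omega c : R) (u u' F : R -> R).
Hypotheses (hn : 2 <= n) (up : periodic u (pi *+ 2))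
  (du : forall x : R, is_derive x (1 : R) u (u' x)) (cu' : continuous u')
  (u_ge0 : forall x, 0 <= u x) (FL2 : L2_Omega F).
Hypothesis htest : forall psi g : R -> R, periodic psi (pi *+ 2) ->
  (forall x : R, is_derive x (1 : R) psi (g x)) -> continuous g ->
  \int[mu]_(x in Omega) (F x * u x `^ n * g x +
    (F x * (n * u x `^ (n - 1) * u' x) - omega * u x - c) * psi x) = 0.

Let cu : continuous u := cts_derive R u u' du.
Let mO := measurable_Omega R.
Let iF : mu.-integrable Omega (EFin \o F) := L2_Omega_integrable R F FL2.

(** Tested with [u ^- n] times a bump [b] supported where [u > 0], the integrated
    equation becomes [F' = - (omega u + c) u ^- n], in the weak form, because
    [u ^ n] times this test function is just [b]. *)
Lemma bump_identity (a h : R) : 0 < h -> 2 * h < pi -> - pi <= a -> a + 3 * h < pi ->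
  (forall x, a + h <= x <= a + 3 * h -> 0 < u x) ->
  mu.-integrable `[a + h, a + 3 * h] (EFin \o (fun x =>
     (omega * u x + c) * (u x `^ (- n) * bump R (a + 2 * h) h (h / 2) x))) /\
  \int[mu]_(x in `[a + h, a + 3 * h]) (F x * bump' R (a + 2 * h) h (h / 2) x) =
  \int[mu]_(x in `[a + h, a + 3 * h])
     ((omega * u x + c) * (u x `^ (- n) * bump R (a + 2 * h) h (h / 2) x)).
Proof.
move=> h0 hpi al ar upos.
pose m := a + 2 * h.
have rd : 0 < h / 2 <= h /\ h < pi by lra.
have ml : m - h = a + h by rewrite /m; ring.
have mr : m + h = a + 3 * h by rewrite /m; ring.
pose b := bump R m h (h / 2); pose b' := bump' R m h (h / 2).
have db (s : R) : is_derive s (1 : R) b (b' s) by exact: is_derive_bump.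
have cb' : continuous b' by exact: continuous_bump'.
have cb := cts_derive R _ _ db.
have bout x : Omega x -> ~~ (a + h <= x <= a + 3 * h) -> cos (x - m) < cos h.
  move=> Ox hx; apply: (bump_support R m h (h / 2) rd) => //; rewrite ?ml ?mr//; lra.
have zout x : u x = 0 -> cos (x - m) < cos h.
  move=> ux; have [k] := period_reduction R 0 x; rewrite subr0 => Ok.
  have -> : cos (x - m) = cos (x + k%:~R * (pi *+ 2) - m).
    by rewrite -(periodicz R _ (@cosD2pi R) k (x - m)); congr cos; ring.
  apply: bout; first by rewrite /Omega/= in_itv.
  apply/negP => /upos; rewrite (periodicz R u up) ux ltxx //.
have nz x : u x = 0 -> \near x, b x = 0 /\ b' x = 0.
  move=> /zout hx; near=> y; apply: (bump_out R m h (h / 2) rd); apply/ltW; near: y.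
  have cc : continuous (fun y : R => cos (y - m)).
    apply: (cts_comp R (fun y => y - m) cos); last exact: continuous_cos.
    by apply: ctsB; [exact: cts_id|exact: cts_cst].
  exact: (cvgr_lt _ (cc x)).
pose psi x := u x `^ (- n) * b x.
pose g x := - n * u x `^ (- n - 1) * u' x * b x + u x `^ (- n) * b' x.
have dpsi (x : R) : is_derive x (1 : R) psi (g x).
  have := u_ge0 x; rewrite le_eqVlt => /orP[/eqP ux|ux].
    have nzx := nz x (esym ux).
    apply: (@near_eq_is_derive _ _ _ (cst 0)).
      by apply: filterS nzx => y [by_ _]; rewrite /psi by_ mulr0.
    have [bx b'x] := nbhs_singleton nzx.
    by rewrite /g bx b'x !mulr0 addr0; exact: is_derive_cst.
  have dp := is_derive_powR_gt0 R u u' (- n) x (du x) ux.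
  have dm := is_deriveM dp (db x).
  by apply: (is_derive_eq dm); rewrite /g /GRing.scale/=; ring.
have cg : continuous g.
  move=> x; have := u_ge0 x; rewrite le_eqVlt => /orP[/eqP ux|ux].
    have nzx := nz x (esym ux).
    have g0 : \near x, cst 0 x = g x.
      by apply: filterS nzx => y [by_ b'y]; rewrite /g by_ b'y !mulr0 addr0.
    rewrite /continuous_at -(nbhs_singleton g0).
    by apply: (cvg_trans (near_eq_cvg g0)); exact: cvg_cst.
  have cp p : {for x, continuous (fun y => u y `^ p)}.
    apply/differentiable_continuous/derivable1_diffP.
    by have [] := is_derive_powR_gt0 R u u' p x (du x) ux.
  apply: cvgD.
    apply: cvgM; last exact: cb.
    by apply: cvgM; [apply: cvgM; [exact: cvg_cst|exact: cp]|exact: cu'].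
  by apply: cvgM; [exact: cp|exact: cb'].
have pp : periodic psi (pi *+ 2).
  by move=> x; rewrite /psi up; congr (_ * _); exact: bump_periodic.
have := htest psi g pp dpsi cg.
rewrite (_ : \int[mu]_(x in Omega) _ = \int[mu]_(x in Omega) (F x * b' x - (omega * u x + c) * psi x)); last first.
  apply: eq_Rintegral => x _; rewrite /psi /g.
  have := u_ge0 x; rewrite le_eqVlt => /orP[/eqP ux|ux].
    have [bx b'x] := nbhs_singleton (nz x (esym ux)).
    by rewrite bx b'x; ring.
  have un0 : u x != 0 by rewrite lt0r_neq0.
  have -> : u x `^ (- n) = (u x `^ n)^-1 by rewrite powRN.
  have -> : u x `^ (- n - 1) = (u x `^ n)^-1 / u x.
    by rewrite powRB ?powRN ?powRr1 ?un0 ?implybT.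
  have -> : u x `^ (n - 1) = u x `^ n / u x.
    by rewrite powRB ?powRr1 ?un0 ?implybT.
  have : u x `^ n != 0 by rewrite lt0r_neq0// powR_gt0.
  by move: (u x `^ n) => P P0; field; rewrite P0.
have sub := itv_sub_Omega R (a + h) (a + 3 * h) (_ : - pi <= a + h) ar.
rewrite (Rintegral_support R `[a + h, a + 3 * h]%classic); last 2 first.
- by apply: sub; lra.
- move=> x Ox xn; have [|bx b'x] := bump_out R m h (h / 2) rd x.
    apply/ltW/bout => //; apply/negP => hx; apply: xn.
    by rewrite /= in_itv.
  by rewrite /b' b'x /psi /b bx; ring.
have mI : measurable (`[a + h, a + 3 * h]%classic : set (measurableTypeR R)) by exact: measurable_itv.
have cpsi := cts_derive R _ _ dpsi.
have al' : - pi <= a + h by lra.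
have iFI : mu.-integrable `[a + h, a + 3 * h] (EFin \o F).
  exact: (integrableS mO mI (sub al')).
have i2 : mu.-integrable `[a + h, a + 3 * h] (EFin \o (fun x => (omega * u x + c) * psi x)).
  apply: (integrable_continuous R (fun x => (omega * u x + c) * psi x) _ (a + h) (a + 3 * h)) => //.
  apply: ctsM => //; apply: ctsD; last exact: cts_cst.
  by apply: ctsM => //; exact: cts_cst.
rewrite RintegralB//; last exact: (integrable_mul_continuous R F b' _ (a + h) (a + 3 * h)).
by move/eqP; rewrite subr_eq0 => /eqP; split.
Unshelve. all: by end_near. Qed.

Let I (a h : R) : set R := `[a + h, a + 3 * h]%classic.
Let beta (a h : R) := bump R (a + 2 * h) h (h / 2).
Let beta' (a h : R) := bump' R (a + 2 * h) h (h / 2).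
Let rhs (a h x : R) := (omega * u x + c) * (u x `^ (- n) * beta a h x).

(** What the estimates at scale [h] assume: [u] vanishes at least to order [3 / 2]
    at [a], and [omega u + c] has the constant sign [sg] to the right of [a].
    All constants except [h] belong to the point [a]. *)
Definition scale_at (a d C sg k h : R) : Prop :=
  [/\ - pi <= a, a + d < pi & forall x, a < x < a + d -> 0 < u x] /\
  [/\ 0 < C & forall y, a < y < pi -> u y <= C * ((y - a) * Num.sqrt (y - a))] /\
  [/\ `|sg| = 1, 0 < k &
    forall x, a < x < a + d -> k * u x <= sg * (omega * u x + c)] /\
  [/\ 0 < h, 3 * h < d, 3 * h <= 1 & C * (3 * h) <= 1].

Let mI a h : measurable (I a h : set (measurableTypeR R)).
Proof. exact: measurable_itv. Qed.

Let beta_ge0 a h x : 0 <= beta a h x.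
Proof. by have /andP[] := bump_bounds R (a + 2 * h) h (h / 2) x. Qed.

Let scale_facts (a d C sg k h : R) : scale_at a d C sg k h ->
  [/\ 0 < h / 2 <= h /\ h < pi, - pi <= a + h, a + 3 * h < pi,
     (forall x, I a h x -> a < x < a + d) & mu.-integrable (I a h) (EFin \o F)].
Proof.
move=> [[al ad _] [_ [_ [h0 hd h31 _]]]].
have pi2 := pi_ge2 R.
have al' : - pi <= a + h by lra.
have ar' : a + 3 * h < pi by lra.
split => //; first by lra.
  by move=> x; rewrite /I/= in_itv/= => /andP[x1 x2]; apply/andP; split; lra.
exact: (integrableS mO (mI a h) (itv_sub_Omega R _ _ al' ar')).
Qed.

Let identity (a d C sg k h : R) : scale_at a d C sg k h ->
  mu.-integrable (I a h) (EFin \o rhs a h) /\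
  \int[mu]_(x in I a h) (F x * beta' a h x) = \int[mu]_(x in I a h) rhs a h x.
Proof.
move=> S; have [rd _ ar' Iin _] := scale_facts _ _ _ _ _ _ S.
have [[al ad upos] [_ [_ [h0 hd h31 _]]]] := S.
have pi2 := pi_ge2 R.
apply: bump_identity => //; first by lra.
by move=> x x12; apply/upos/Iin; rewrite /I/= in_itv.
Qed.

(** On the middle half of the support the bump is 1, so that the integrand there
    is at least [k u ^ (1 - n)], which is at least [k / u] since [u <= 1] and
    [2 <= n]; the growth bound turns this into a multiple of [h ^ (- 3 / 2)]. *)
Lemma one_scale_lower (a d C sg k h : R) : scale_at a d C sg k h ->
  k / (3 * C * Num.sqrt (3 * h)) <= \int[mu]_(x in I a h) (sg * rhs a h x).
Proof.
move=> S; have [rd al' ar' Iin iFI] := scale_facts _ _ _ _ _ _ S.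
have [irhs _] := identity _ _ _ _ _ _ S.
have [[al ad upos] [[C0 growth] [[sg1 k0 lower] [h0 hd h31 Ch]]]] := S; clear S.
pose q := Num.sqrt (3 * h); rewrite -/q.
have q0 : 0 < q by rewrite sqrtr_gt0 mulr_gt0.
have q2 : q ^+ 2 = 3 * h by rewrite sqr_sqrtr// mulr_ge0// ltW.
have q1 : q <= 1 by rewrite -(expr_le1 (n := 2)) ?q2// ltW.
have hq : h = q ^+ 2 / 3 by rewrite q2; field.
pose J : set R := `[a + 3 / 2 * h, a + 5 / 2 * h]%classic.
have mJ : measurable (J : set (measurableTypeR R)) by exact: measurable_itv.
have JI : J `<=` I a h by apply: subset_itv; rewrite bnd_simp; lra.
have isg : mu.-integrable (I a h) (EFin \o (fun x => sg * rhs a h x)).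
  exact: integrable_EFinZ.
have rhs_ge x : I a h x -> k * u x * (u x `^ (- n) * beta a h x) <= sg * rhs a h x.
  move=> /Iin Ix; rewrite /rhs [sg * _]mulrA ler_wpM2r//; last exact: lower.
  by rewrite mulr_ge0 ?powR_ge0.
apply: (@le_trans _ _ (\int[mu]_(x in J) (sg * rhs a h x))); last first.
  apply: Rintegral_subset => // x Ix; apply: le_trans (rhs_ge x Ix).
  by rewrite mulr_ge0 ?mulr_ge0 ?(ltW k0)// powR_ge0.
have -> : k / (3 * C * q) = \int[mu]_(x in J) (k / (C * (q ^+ 2 * q))).
  rewrite Rintegral_cst//; have := lebesgue_measure_itv `[a + 3 / 2 * h, a + 5 / 2 * h].
  rewrite /= lte_fin (_ : a + 3 / 2 * h < a + 5 / 2 * h); last by lra.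
  move=> ->; rewrite /= (_ : a + 5 / 2 * h - (a + 3 / 2 * h) = h); last by field.
  by rewrite hq; field; rewrite !lt0r_neq0.
apply: le_Rintegral => //.
- by apply: (integrable_continuous R (fun=> _) _ (a + 3 / 2 * h) (a + 5 / 2 * h)) => //; exact: cts_cst.
- exact: (@integrableS _ _ R mu _ _ _ _ _ JI isg).
- move=> x Jx; apply: le_trans (rhs_ge x (JI x Jx)).
  have ux0 : 0 < u x by apply/upos/Iin/JI.
  move: Jx; rewrite /J/= in_itv/= => /andP[x1 x2].
  have [|bx _] := bump_plateau R (a + 2 * h) h (h / 2) rd x.
    by rewrite ler_norml; lra.
  rewrite /beta bx mulr1.
  have xa : 0 <= x - a <= 3 * h by lra.
  have xpi : a < x < pi by lra.
  have uxle : u x <= C * (q ^+ 2 * q).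
    have /andP[xa0 xa3] := xa.
    by rewrite (le_trans (growth x xpi))// ler_pM2l// q2 ler_pM ?sqrtr_ge0// ler_wsqrtr.
  have Cq1 : C * (q ^+ 2 * q) <= 1.
    by rewrite mulrA q2 mulr_ile1 ?(ltW q0)// mulr_ge0 ?(ltW C0)// mulr_ge0// ltW.
  have ux1 : u x <= 1 := le_trans uxle Cq1.
  have un : u x `^ n <= u x ^+ 2.
    by rewrite -powR_mulrn ?u_ge0//; apply: ger_powR => //; rewrite ux0.
  rewrite powRN -mulrA ler_pM2l//.
  apply: (@le_trans _ _ ((u x)^-1)); first by rewrite lef_pV2 ?posrE// !mulr_gt0 ?exprn_gt0.
  have -> : (u x)^-1 = u x / u x ^+ 2 by field; rewrite lt0r_neq0.
  by rewrite ler_pM2l// lef_pV2 ?posrE ?powR_gt0 ?exprn_gt0.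
Qed.

(** The slope of the bump is of order [1 / h] and its support has length [2 h]. *)
Lemma one_scale_upper (a d C sg k h t : R) : scale_at a d C sg k h -> 0 < t ->
  \int[mu]_(x in I a h) (sg * rhs a h x) <=
  16 / (cos 1 * h) * ((t * \int[mu]_(x in I a h) (F x ^+ 2) + 2 * h / t) / 2).
Proof.
move=> S t0; have [rd al' ar' Iin iFI] := scale_facts _ _ _ _ _ _ S.
have [irhs int_eq] := identity _ _ _ _ _ _ S.
have [_ [_ [[sg1 k0 _] [h0 hd h31 _]]]] := S; clear S.
have c1 := @cos1_gt0 R.
have iFb : mu.-integrable (I a h) (EFin \o (fun x => F x * beta' a h x)).
  apply: (integrable_mul_continuous R F _ _ (a + h) (a + 3 * h)) => //.
  exact: continuous_bump'.
rewrite RintegralZl// -int_eq (le_trans (ler_norm _))// normrM sg1 mul1r.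
apply: (le_trans (le_normr_Rintegral (mI a h) iFb)).
have slope x : I a h x -> `|beta' a h x| <= 16 / (cos 1 * h).
  rewrite /I/= in_itv/= => /andP[x1 x2].
  have xm : `|x - (a + 2 * h)| <= h by rewrite ler_norml; lra.
  apply: (le_trans (norm_bump'_le R (a + 2 * h) h (h / 2) rd x xm)).
  have h01 : 0 < h <= 1 by lra.
  have := bump_gap R h (h / 2) rd; have := cos_half_gap R h h01.
  rewrite (_ : h - h / 2 = h / 2); last by field.
  move: (cos (h / 2) - cos h) => G hG G0.
  rewrite ler_pdivrMr// mulrAC ler_pdivlMr ?mulr_gt0//.
  have -> : 4 * h * (cos 1 * h) = 4 * (cos 1 * h ^+ 2) by ring.
  by lra.
apply: (@le_trans _ _ (\int[mu]_(x in I a h) (16 / (cos 1 * h) * `|F x|))).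
  apply: le_Rintegral => //.
  - exact: integrable_norm iFb.
  - by apply: integrable_EFinZ => //; exact: integrable_norm iFI.
  - by move=> x Ix; rewrite normrM mulrC ler_wpM2r// slope.
rewrite RintegralZl//; last exact: integrable_norm iFI.
rewrite ler_pM2l ?divr_gt0 ?mulr_gt0//.
have ahh : a + h <= a + 3 * h by lra.
apply: (le_trans (Rintegral_AMGM R F FL2 _ _ _ al' ar' ahh t0)).
by rewrite (_ : a + 3 * h - (a + h) = 2 * h)//; ring.
Qed.

(** Both sides of the identity scale like [h ^ (- 1 / 2)], so that comparing them
    leaves a lower bound on the local [L2] norm of [F] in which [h] no longer
    appears. *)
Lemma one_scale_bound (a d C sg k h : R) : scale_at a d C sg k h ->
  (k * cos 1 / (72 * C)) ^+ 2 / 3 <=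
  \int[mu]_(x in `[a + h, a + 3 * h]) (F x ^+ 2).
Proof.
move=> S; have := one_scale_lower _ _ _ _ _ _ S.
have := one_scale_upper _ _ _ _ _ _ (Num.sqrt (3 * h) / (k * cos 1 / (72 * C))) S.
have [_ [[C0 _] [[_ k0 _] [h0 _ _ _]]]] := S; clear S.
rewrite -[`[a + h, a + 3 * h]%classic]/(I a h).
have c1 := @cos1_gt0 R.
pose K : R := k * cos 1 / (72 * C); rewrite -/K.
have K0 : 0 < K by rewrite divr_gt0 ?mulr_gt0.
have q0 : 0 < Num.sqrt (3 * h) by rewrite sqrtr_gt0 mulr_gt0.
have hq : h = Num.sqrt (3 * h) ^+ 2 / 3.
  by rewrite sqr_sqrtr; [field|rewrite mulr_ge0// ltW].
rewrite divr_gt0// => /(_ isT) ub lb.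
have := le_trans lb ub; move: (\int[mu]_(x in I a h) (F x ^+ 2)) => E; clear lb ub.
move: q0 hq; move: (Num.sqrt _) => q q0 ->.
have -> : k / (3 * C * q) = 24 / (cos 1 * q) * K.
  by rewrite /K; field; rewrite !lt0r_neq0.
have -> : 16 / (cos 1 * (q ^+ 2 / 3)) * ((q / K * E + 2 * (q ^+ 2 / 3) / (q / K)) / 2) =
   24 / (cos 1 * q) * (E / K + 2 * K / 3).
  by field; rewrite !lt0r_neq0.
rewrite ler_pM2l ?divr_gt0 ?mulr_gt0//; clearbody K => le1.
have le2 : K / 3 <= E / K by lra.
by move: le2; rewrite ler_pdivlMr// => le2; lra.
Qed.

End near_a_zero.

(** * Conclusion *)

(** If [c = 0] the expression is a multiple of [u]; otherwise it is close to [c] near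
    [a], where [u] is small. *)
Lemma linear_lower_bound (R : realType) (u : R -> R) (omega c a : R) :
  {for a, continuous u} -> u a = 0 -> (forall x, 0 <= u x) -> omega != 0 ->
  exists sg k d : R, [/\ `|sg| = 1, 0 < k, 0 < d &
    forall x, a < x < a + d -> k * u x <= sg * (omega * u x + c)].
Proof.
move=> cu ua u0 om0; have [->|c0] := eqVneq c 0.
  exists (Num.sg omega), `|omega|, 1; split => //; rewrite ?normr_gt0//.
    by rewrite normr_sg om0.
  by move=> x _; rewrite addr0 mulrA -normrEsg.
have cp : 0 < `|c| by rewrite normr_gt0.
have op : 0 < `|omega| by rewrite normr_gt0.
pose e := Num.min 1 (`|c| / (2 * `|omega|)).
have e0 : 0 < e by rewrite lt_min ltr01 divr_gt0 ?mulr_gt0.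
have /cvgrPdist_lt /(_ e e0) [d /= d0 hd] := cu.
exists (Num.sg c), (`|c| / 2), d; split => //.
- by rewrite normr_sg c0.
- by rewrite divr_gt0.
move=> x /andP[ax xd].
have : `|u a - u x| < e by apply: hd; rewrite /= ltr_norml; lra.
rewrite ua sub0r normrN (ger0_norm (u0 x)) lt_min ltr_pdivlMr ?mulr_gt0// => /andP[ux1 ux2].
rewrite mulrDr -normrEsg.
have h1 : - (`|omega| * u x) <= Num.sg c * (omega * u x).
  apply: lerNnormlW; rewrite normrM normr_sg c0 mul1r normrM (ger0_norm (u0 x)).
  by [].
have h2 : `|c| / 2 * u x <= `|c| / 2 by rewrite ler_piMr ?ltW// divr_gt0.
by lra.
Qed.

Lemma exists_small_scale (R : realType) (d e C : R) : 0 < d -> 0 < e -> 0 < C ->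
  exists h : R, [/\ 0 < h, 3 * h < d, 3 * h <= 1, C * (3 * h) <= 1 & 2 * h < e].
Proof.
move=> d0 e0 C0.
have [Ci Ci0 CCi] : exists2 Ci : R, 0 < Ci & C * Ci = 1.
  by exists C^-1; rewrite ?invr_gt0// divff// lt0r_neq0.
exists (Num.min (Num.min d 1) (Num.min e Ci) / 4).
set m := Num.min _ _.
have m0 : 0 < m by rewrite !lt_min d0 e0 Ci0 ltr01.
have [[hd h1] [he hC]] : (m <= d /\ m <= 1) /\ (m <= e /\ m <= Ci).
  by rewrite /m !ge_min !lexx !orbT.
clearbody m; split; [by lra..| |by lra].
by have := ler_wpM2l (ltW C0) hC; lra.
Qed.

Theorem proposition2 (R : realType) (n omega : R) (u : R -> R)
    (hn : 2 <= n)
    (hu : H2_per u)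
    (u_ge0 : forall x : R, 0 <= u x)
    (u_neq0 : exists x : R, u x != 0)
    (hsol : weak_solution n omega u)
    (hS : positivity_set u <> Omega) :
  omega = 0.
Proof.
have [up _ _ dru cu'] := hu.
have [w wd sol] := hsol.
have [p up0] := u_neq0.
pose u' : R -> R := u^`()%classic.
have du (x : R) : is_derive x (1 : R) u (u' x).
  by apply: DeriveDef; [exact: dru|rewrite /u' derive1E].
have cu := cts_derive R u u' du.
(* Otherwise [u] would be positive on the whole period. *)
have [z uz] : exists z, u z = 0.
  apply: contrapT => nz; apply: hS; apply/seteqP; split => [x []//|x Ox].
  split => //; rewrite lt0r u_ge0 andbT; apply/eqP => ux; apply: nz.
  by exists x.
have [a [d1 [al d10 ar ua upos]]] := zero_with_positive_right R u z p cu up u_ge0 uz up0.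
have u'a := derive_at_zero R u u' a du u_ge0 ua.
have [C C0 growth] := growth_at_zero R u u' w up du cu' wd a al ua u'a.
pose F x := w x + u x + cos x.
have FL2 : L2_Omega F.
  rewrite (_ : F = (fun x => w x + (u x + cos x))); last first.
    by apply/funext => x; rewrite /F addrA.
  apply: L2_Omega_add_continuous; first exact: wd.1.
  by apply: ctsD => //; exact: continuous_cos.
have [c test] := exists_integration_constant R n omega u u' F hn du cu' u_ge0 FL2 sol.
apply/eqP; apply: contraT => om0.
have [sg [k [d2 [sg1 k0 d20 lower]]]] :=
  linear_lower_bound R u omega c a (cu a) ua u_ge0 om0.
have K0 : 0 < (k * cos 1 / (72 * C)) ^+ 2 / 3.
  by rewrite divr_gt0// exprn_gt0// divr_gt0 ?mulr_gt0// cos1_gt0.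
have iF2 : (@lebesgue_measure R).-integrable setT (EFin \o ((fun x => F x ^+ 2) \_ Omega)).
  rewrite -restrict_EFin.
  apply/(integrable_mkcond (mu := @lebesgue_measure R) _ (measurable_Omega R)).
  by have [_] := FL2.
have [e [e0 small]] := integral_normr_continuous iF2 K0.
pose d := Num.min d1 d2.
have d0 : 0 < d by rewrite lt_min d10.
have [dd1 dd2] : d <= d1 /\ d <= d2 by rewrite !ge_min !lexx orbT.
clearbody d.
have [h [h0 h3d h31 Ch h2e]] := exists_small_scale R d e C d0 e0 C0.
have adpi : a + d < pi by apply: le_lt_trans ar; rewrite lerD2l.
have scale : scale_at R omega c u a d C sg k h.
  do ![split=> //] => x /andP[ax xd].
    by apply: upos; rewrite ax (lt_le_trans xd)// lerD2l.
  by apply: lower; rewrite ax (lt_le_trans xd)// lerD2l.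
have := one_scale_bound R n omega c u u' F hn up du cu' u_ge0 FL2 test a d C sg k h scale.
rewrite leNgt => /negP[].
have hh : h < 3 * h by rewrite ltr_pMl// ltr1n.
have sub : `[a + h, a + 3 * h]%classic `<=` @Omega R.
  apply: itv_sub_Omega; first by rewrite (le_trans al)// lerDl ltW.
  by apply: lt_trans adpi; rewrite ltrD2l.
have mI : measurable (`[a + h, a + 3 * h]%classic : set (measurableTypeR R)) by exact: measurable_itv.
have := small _ mI; have := lebesgue_measure_itv `[a + h, a + 3 * h].
rewrite /= lte_fin ltrD2l hh => ->.
rewrite -EFinD lte_fin (_ : a + 3 * h - (a + h) = 2 * h); last by ring.
rewrite h2e => /(_ isT); congr (_ < _); apply: eq_Rintegral => x xI.
rewrite patchE mem_set; last by apply: sub; exact: set_mem.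
by rewrite ger0_norm ?sqr_ge0.
Qed.
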